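(* Suppose that $f(z)=h(z)+\overline{g(z)}=\sum_{k=0}^\infty a_k z^k+\overline{\sum_{k=1}^\infty b_k z^k}$ is a harmonic mapping of the unit disk $\mathbb{D}=\{z\in\mathbb{C}:|z|<1\}$, where $h$ and $g$ are analytic in $\mathbb{D}$, $|h(z)|<1$ and $|g'(z)|=|zh'(z)|$ for all $z\in\mathbb{D}$. Then $$|a_0|+\sum_{k=1}^\infty(|a_k|+|b_k|)r^k\le 1\quad\text{for } r\le r_0,$$ where $r_0\approx 0.299824$ is the solution in $(0,1)$ of the equation $$5x+2(1-x)\log(1-x)=1.$$ The constant $r_0$ is the best possible.
   Context: Here $0\le r<1$. ''Best possible'' means that if $r_0$ is replaced by any larger number, the inequality fails for some $f$ satisfying the hypotheses and some $r$ in the corresponding range. *)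

(* Defs.v *)
From Stdlib Require Export Reals.
From Coquelicot Require Export Coquelicot.
Open Scope R_scope.

Definition in_disk (z : C) : Prop := Cmod z < 1.

(* [ex_derive] elaborates to complex differentiability
   ([K := C_AbsRing], [V := C_NormedModule]). *)
Definition analytic_in_disk (h : C -> C) : Prop :=
  forall z : C, in_disk z -> ex_derive h z.

Definition harmonic_fun_in_disk (u : R -> R -> R) : Prop :=
  forall x y : R, in_disk (x, y) ->
    ex_diff_n u 2 x y /\ partial_derive 2 0 u x y + partial_derive 0 2 u x y = 0.

(* As usual for "harmonic mappings" written h + conj g, univalence is not
   part of the notion. *)
Definition harmonic_mapping_in_disk (f : C -> C) : Prop :=
  harmonic_fun_in_disk (fun x y : R => Re (f (x, y))) /\
  harmonic_fun_in_disk (fun x y : R => Im (f (x, y))).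

(* [hb_b0] is an encoding device: the expansion of [g] starts at [k = 1].
   [C_derive] is only evaluated where the functions are differentiable, by
   [hb_h_analytic] and [hb_g_analytic]. *)
Record harmonic_bohr_class (f h g : C -> C) (a b : nat -> C) : Prop := {
  hb_harmonic : harmonic_mapping_in_disk f;
  hb_f : forall z : C, in_disk z -> f z = (h z + Cconj (g z))%C;
  hb_h_analytic : analytic_in_disk h;
  hb_g_analytic : analytic_in_disk g;
  hb_h_series : forall z : C, in_disk z -> is_pseries a z (h z);
  hb_b0 : b 0%nat = RtoC 0;
  hb_g_series : forall z : C, in_disk z -> is_pseries b z (g z);
  hb_h_bound : forall z : C, in_disk z -> Cmod (h z) < 1;
  hb_dilatation : forall z : C, in_disk z ->
    Cmod (C_derive g z) = Cmod (z * C_derive h z)%C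
}.

(* Convergence is part of the inequality: a divergent series of nonnegative
   terms has sum +oo and violates it. *)
Definition bohr_inequality (a b : nat -> C) (r : R) : Prop :=
  exists s : R,
    is_series (fun k : nat => (Cmod (a (S k)) + Cmod (b (S k))) * r ^ S k) s /\
    Cmod (a 0%nat) + s <= 1.

(* Main.v *)
Require Import Defs.
From Stdlib Require Import Reals Ranalysis5 Lra Lia Psatz.
From Coquelicot Require Import Coquelicot.
Open Scope R_scope.

(** Both halves rest on the sizes of the Taylor coefficients.

    Parseval's identity ([parseval]) says that the mean of |F|^2 over the circle
    |z| = r is the sum of |c_k|^2 r^(2k); it is obtained here with means over the
    N-th roots of unity, N tending to infinity, in place of an integral.  It has
    two uses.

    - Two power series of equal modulus throughout the disk have equal means on
      every circle, so their coefficients have equal moduli ([Cmod_coeff_eq]).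
      Applied to |g'| = |z h'|, this gives (k+1) |b_(k+1)| = k |a_k|
      ([bohr_class_coeff]) without first showing that g' / (z h') is a constant.
    - If |h| <= 1, comparing h(z) (x + y z^n) with x + y z^n on circles and keeping
      only the coefficients of 1 and z^n shows that the matrix with rows (a_0, 0),
      (a_n, a_0) is a contraction, whence |a_n| <= 1 - |a_0|^2
      ([bounded_coeff_le]).

    With A = |a_0| the sum to be bounded is then at most
    A + (1 - A^2) S(r), where S(r) is the sum over k >= 1 of
    r^k + (k/(k+1)) r^(k+1), that is S(r) = 2r/(1-r) + log(1-r)
    ([is_series_bohr_majorant]).  The bound is at most 1 for every A in [0,1)
    exactly when 2 S(r) <= 1, which after multiplication by 1 - r reads
    5r + 2(1-r) log(1-r) <= 1.  The left-hand side is strictly increasing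
    ([bohr_fun_incr]), so this means r <= r_0; the decimals of r_0 come from
    partial sums of the logarithmic series with a geometric bound on the tail.

    The constant is sharp because for h(z) = (al - z)/(1 - al z) all the coefficient
    bounds become equalities up to powers of al.  The associated g is the power
    series with g' = z h' and g(0) = 0, and when al is close to 1 the sum
    exceeds 1 at some r slightly larger than r_0 ([mobius_not_bohr]).  That
    h + conj g is a harmonic mapping follows from the fact that the real part of a
    convergent power series is harmonic ([harmonic_Re]). *)

(** * Complex power series in the unit disk *)

Notation is_cseries := (@is_series C_AbsRing C_NormedModule).
Notation is_cpseries := (@is_pseries C_AbsRing C_NormedModule).

(** The radius of convergence is at least 1, in the form that comparison tests use. *)
Definition disk_coeffs (c : nat -> C) : Prop :=
  forall r : R, 0 <= r < 1 -> ex_series (fun k => Cmod (c k) * r ^ k).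

Lemma pow_n_Cpow (z : C) (k : nat) : @pow_n C_AbsRing z k = (z ^ k)%C.
Proof. induction k as [|k IH]; simpl; [reflexivity|]. now rewrite IH. Qed.

Lemma is_cpseries_iff (c : nat -> C) (z l : C) :
  is_cpseries c z l <-> is_cseries (fun k => z ^ k * c k)%C l.
Proof.
  split; apply is_series_ext; intros k.
  - exact (f_equal (fun x => (x * c k)%C) (pow_n_Cpow z k)).
  - exact (f_equal (fun x => (x * c k)%C) (eq_sym (pow_n_Cpow z k))).
Qed.

Lemma filterlim_seq_norm (u : nat -> C) (l : C) :
  filterlim u eventually (locally (T:=C_NormedModule) l) ->
  is_lim_seq (fun n => Cmod (u n)) (Cmod l).
Proof.
  intros H. apply (filterlim_comp _ _ _ u (@norm _ C_NormedModule) _ _ _ H).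
  exact (filterlim_norm (V:=C_NormedModule) l).
Qed.

Lemma is_cseries_unique (u : nat -> C) (l l' : C) :
  is_cseries u l -> is_cseries u l' -> l = l'.
Proof.
  intros H H'.
  exact (filterlim_locally_unique (V:=C_NormedModule) _ _ _ H H').
Qed.

Lemma Cmod_is_cseries_le (u : nat -> C) (v : nat -> R) (l : C) (s : R) :
  (forall k, Cmod (u k) <= v k) -> is_cseries u l -> is_series v s -> Cmod l <= s.
Proof.
  intros Huv Hu Hs.
  assert (H1 := filterlim_seq_norm _ _ Hu).
  apply (is_lim_seq_le _ _ (Finite (Cmod l)) (Finite s)) with (2 := H1) (3 := Hs).
  intros n. eapply Rle_trans; [exact (norm_sum_n_m (V:=C_NormedModule) u 0 n)|].
  apply sum_n_m_le. exact Huv.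
Qed.

(** If the series converges at a point of modulus rho > r, its terms there are bounded by
    some M, and |c_k| r^k is dominated by the geometric sequence M (r/rho)^k. *)
Lemma disk_coeffs_of_cv (c : nat -> C) :
  (forall z, in_disk z -> exists l, is_cpseries c z l) -> disk_coeffs c.
Proof.
  intros H r Hr.
  set (rho := (r + 1) / 2).
  assert (Hrho : 0 < rho < 1) by (unfold rho; lra).
  destruct (H (RtoC rho)) as [l Hl].
  { unfold in_disk. rewrite Cmod_R, Rabs_pos_eq; lra. }
  rewrite is_cpseries_iff in Hl.
  destruct (filterlim_bounded (V:=C_NormedModule)
    (sum_n (G:=C_NormedModule) (fun k => RtoC rho ^ k * c k)%C)) as [M HM].
  { exists l. exact Hl. }
  assert (Hb : forall k, Cmod (c k) * rho ^ k <= 2 * M).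
  { intros k.
    assert (E : Cmod (c k) * rho ^ k = Cmod (RtoC rho ^ k * c k)).
    { rewrite Cmod_mult, Cmod_pow, Cmod_R, Rabs_pos_eq; lra. }
    rewrite E. destruct k as [|k].
    - specialize (HM 0%nat). rewrite sum_O in HM.
      assert (0 <= M) by (eapply Rle_trans; [apply (norm_ge_0 (V:=C_NormedModule))|exact HM]).
      change (Cmod (RtoC rho ^ 0 * c 0%nat) <= M) in HM. lra.
    - assert (H1 := HM k). assert (H2 := HM (S k)).
      rewrite sum_Sn in H2.
      set (s := sum_n _ k) in *.
      change (Cmod s <= M) in H1.
      change (Cmod (s + RtoC rho ^ S k * c (S k)) <= M) in H2.
      replace (RtoC rho ^ S k * c (S k))%C
        with ((s + RtoC rho ^ S k * c (S k)) + - s)%C by ring.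
      eapply Rle_trans; [apply Cmod_triangle|]. rewrite Cmod_opp. lra. }
  apply (ex_series_le (V:=R_CompleteNormedModule)) with (fun k => 2 * M * (r / rho) ^ k).
  - intros k. change (Rabs (Cmod (c k) * r ^ k) <= 2 * M * (r / rho) ^ k).
    rewrite Rabs_pos_eq.
    2: { apply Rmult_le_pos; [apply Cmod_ge_0|apply pow_le; lra]. }
    unfold Rdiv. rewrite Rpow_mult_distr, pow_inv.
    assert (0 < rho ^ k) by (apply pow_lt; lra).
    replace (Cmod (c k) * r ^ k) with (Cmod (c k) * rho ^ k * (r ^ k * / rho ^ k)) by (field; lra).
    apply Rmult_le_compat_r; [|apply Hb].
    apply Rmult_le_pos; [apply pow_le; lra|]. left. now apply Rinv_0_lt_compat.
  - apply (ex_series_scal (V:=R_NormedModule)). apply ex_series_geom.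
    rewrite Rabs_pos_eq.
    + apply Rmult_lt_reg_r with rho; [lra|]. unfold Rdiv. rewrite Rmult_assoc, Rinv_l by lra.
      unfold rho in *; lra.
    + apply Rmult_le_pos; [lra|]. left. apply Rinv_0_lt_compat; lra.
Qed.

Lemma disk_coeffs_cv (c : nat -> C) (z : C) :
  disk_coeffs c -> in_disk z -> exists l, is_cpseries c z l.
Proof.
  intros H Hz.
  destruct (ex_series_le (V:=C_CompleteNormedModule) (fun k => z ^ k * c k)%C
    (fun k => Cmod (c k) * Cmod z ^ k)) as [l Hl].
  - intros k. change (Cmod (z ^ k * c k) <= Cmod (c k) * Cmod z ^ k).
    rewrite Cmod_mult, Cmod_pow. lra.
  - apply H. split; [apply Cmod_ge_0|exact Hz].
  - exists l. apply is_cpseries_iff. exact Hl.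
Qed.

(** Gives access to the real theory, where differentiating a power series is known to
    preserve its radius of convergence. *)
Lemma disk_coeffs_radius (c : nat -> C) :
  disk_coeffs c <-> Rbar_le 1 (CV_radius (fun k => Cmod (c k))).
Proof.
  split.
  - intros H. apply Rbar_not_lt_le. intros Hlt.
    assert (H0 := CV_radius_ge_0 (fun k => Cmod (c k))).
    destruct (CV_radius (fun k => Cmod (c k))) as [x| |] eqn:E; simpl in *; try easy.
    apply (CV_disk_outside (fun k => Cmod (c k)) ((x + 1) / 2)).
    + rewrite E. simpl. rewrite Rabs_pos_eq; lra.
    + apply ex_series_lim_0, H. lra.
  - intros H r Hr.
    apply ex_series_ext with (fun k => Rabs (Cmod (c k) * r ^ k)).
    { intros k. apply Rabs_pos_eq. apply Rmult_le_pos; [apply Cmod_ge_0|apply pow_le; lra]. }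
    apply CV_disk_inside. eapply Rbar_lt_le_trans; [|exact H].
    simpl. rewrite Rabs_pos_eq; lra.
Qed.

Definition cderive (c : nat -> C) (k : nat) : C := (RtoC (INR (S k)) * c (S k))%C.

Lemma disk_coeffs_cderive (c : nat -> C) : disk_coeffs c -> disk_coeffs (cderive c).
Proof.
  rewrite !disk_coeffs_radius. intros H.
  rewrite (CV_radius_ext _ (PS_derive (fun k => Cmod (c k)))).
  - now rewrite CV_radius_derive.
  - intros k. unfold cderive, PS_derive.
    rewrite Cmod_mult, Cmod_R, Rabs_pos_eq; [reflexivity|apply pos_INR].
Qed.

(** The remainders D_k = w^k - z^k - k z^(k-1) (w - z) satisfy
    D_(k+1) = w D_k + k z^(k-1) (w - z)^2, so the bound follows by induction on k. *)
Lemma pow_second_order (rho : R) (z w : C) (k : nat) :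
  Cmod z <= rho -> Cmod w <= rho ->
  Cmod (w ^ S (S k) - z ^ S (S k) - RtoC (INR (S (S k))) * z ^ S k * (w - z))
    <= INR (S (S k)) * INR (S k) * rho ^ k * Cmod (w - z) ^ 2.
Proof.
  intros Hz Hw.
  assert (Hrho : 0 <= rho) by (eapply Rle_trans; [apply Cmod_ge_0|exact Hz]).
  assert (Hzk : forall m, Cmod z ^ m <= rho ^ m).
  { intros m. apply pow_incr. split; [apply Cmod_ge_0|exact Hz]. }
  induction k as [|k IH].
  - simpl (INR _). rewrite <- Cmod_pow.
    replace (w ^ 2 - z ^ 2 - RtoC (1 + 1) * z ^ 1 * (w - z))%C with ((w - z) ^ 2)%C.
    2: { rewrite RtoC_plus. ring. }
    assert (0 <= Cmod ((w - z) ^ 2)) by apply Cmod_ge_0. simpl (rho ^ 0). lra.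
  - set (D := (w ^ S (S k) - z ^ S (S k) - RtoC (INR (S (S k))) * z ^ S k * (w - z))%C) in *.
    replace (w ^ S (S (S k)) - z ^ S (S (S k)) - RtoC (INR (S (S (S k)))) * z ^ S (S k) * (w - z))%C
      with (w * D + RtoC (INR (S (S k))) * z ^ S k * (w - z) ^ 2)%C.
    2: { unfold D. rewrite (S_INR (S (S k))), RtoC_plus. rewrite !Cpow_S. ring. }
    eapply Rle_trans; [apply Cmod_triangle|].
    rewrite !Cmod_mult, !Cmod_pow, Cmod_R, Rabs_pos_eq by apply pos_INR.
    assert (HD : 0 <= Cmod D) by apply Cmod_ge_0.
    assert (Hq : 0 <= Cmod (w - z) ^ 2) by apply pow2_ge_0.
    specialize (Hzk (S k)).
    set (q := Cmod (w - z) ^ 2) in *.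
    assert (H1 : Cmod w * Cmod D <= rho * (INR (S (S k)) * INR (S k) * rho ^ k * q)).
    { apply Rmult_le_compat; auto. apply Cmod_ge_0. }
    assert (H2 : INR (S (S k)) * Cmod z ^ S k * q <= INR (S (S k)) * rho ^ S k * q).
    { apply Rmult_le_compat_r; auto. apply Rmult_le_compat_l; auto. apply pos_INR. }
    assert (H3 : 0 <= rho ^ S k * q) by (apply Rmult_le_pos; auto; apply pow_le; auto).
    assert (Hk := pos_INR k).
    assert (E : INR (S (S (S k))) * INR (S (S k)) * rho ^ S k * q =
      rho * (INR (S (S k)) * INR (S k) * rho ^ k * q) + INR (S (S k)) * rho ^ S k * q
       + INR (S (S k)) * (rho ^ S k * q)).
    { rewrite !S_INR. simpl. ring. }
    rewrite E.
    assert (0 <= INR (S (S k)) * (rho ^ S k * q)) by (apply Rmult_le_pos; auto; apply pos_INR).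
    lra.
Qed.

(** * Termwise differentiation *)

(** The terms of index 0 and 1 of the remainder vanish, which is why the series can
    start at index 2, where [pow_second_order] applies. *)
Lemma cpseries_remainder (c : nat -> C) (z w Fz Fw F'z : C) :
  is_cpseries c z Fz -> is_cpseries c w Fw -> is_cpseries (cderive c) z F'z ->
  is_cseries (fun k => (w ^ S (S k) - z ^ S (S k) - RtoC (INR (S (S k))) * z ^ S k * (w - z))
                         * c (S (S k)))%C
    (Fw - Fz - F'z * (w - z))%C.
Proof.
  rewrite !is_cpseries_iff. intros Hz Hw Hd.
  set (u := fun k => match k with O => RtoC 0 | S k => (z ^ k * cderive c k)%C end).
  assert (Hu : is_cseries u F'z).
  { apply is_series_decr_1. simpl.
    change (is_cseries (fun k => z ^ k * cderive c k)%C (F'z + - 0)%C).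
    replace (F'z + - 0)%C with F'z by ring. exact Hd. }
  assert (Hu' := is_series_scal (V:=C_NormedModule) (w - z)%C _ _ Hu).
  assert (HR := is_series_minus _ _ _ _ (is_series_minus _ _ _ _ Hw Hz) Hu').
  set (R := fun k => _) in HR.
  assert (HR2 : is_cseries (fun k => R (S (S k))) (Fw - Fz - F'z * (w - z))%C).
  { apply (is_series_incr_1 (fun k => R (S k))). apply (is_series_incr_1 R).
    assert (E : plus (plus (Fw - Fz - F'z * (w - z))%C (R 1%nat)) (R 0%nat) =
      (minus (minus Fw Fz) (scal (w - z)%C F'z))).
    { unfold R, u, cderive.
      change (Fw - Fz - F'z * (w - z) + (w ^ 1 * c 1%nat - z ^ 1 * c 1%nat - (w - z) * (z ^ 0 * (RtoC (INR 1) * c 1%nat)))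
        + (w ^ 0 * c 0%nat - z ^ 0 * c 0%nat - (w - z) * 0) = Fw - Fz - (w - z) * F'z)%C.
      change (INR 1) with 1. ring. }
    exact (eq_ind _ (is_cseries R) HR _ (eq_sym E)). }
  apply is_series_ext with (2 := HR2).
  intros k. unfold R, u, cderive.
  change ((w ^ S (S k) * c (S (S k)) - z ^ S (S k) * c (S (S k)) -
    (w - z) * (z ^ S k * (RtoC (INR (S (S k))) * c (S (S k)))) =
    (w ^ S (S k) - z ^ S (S k) - RtoC (INR (S (S k))) * z ^ S k * (w - z)) * c (S (S k)))%C).
  ring.
Qed.

(** The constant K is the sum of (k+1) (k+2) |c_(k+2)| rho^k. *)
Lemma cpseries_remainder_le (c : nat -> C) (F F' : C -> C) (rho : R) :
  disk_coeffs c -> 0 <= rho < 1 ->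
  (forall z, in_disk z -> is_cpseries c z (F z)) ->
  (forall z, in_disk z -> is_cpseries (cderive c) z (F' z)) ->
  exists K, 0 <= K /\ forall z w, Cmod z <= rho -> Cmod w <= rho ->
    Cmod (F w - F z - F' z * (w - z)) <= K * Cmod (w - z) ^ 2.
Proof.
  intros Hc Hrho HF HF'.
  destruct (disk_coeffs_cderive _ (disk_coeffs_cderive _ Hc) rho Hrho) as [K HK].
  exists K. split.
  { apply Rle_trans with (Series (fun _ => 0)).
    - rewrite (Series_ext _ (fun n => 0 * 0)) by (intros; ring). rewrite Series_scal_l. lra.
    - rewrite <- (is_series_unique _ _ HK). apply Series_le; [|now exists K].
      intros n. split; [lra|]. apply Rmult_le_pos; [apply Cmod_ge_0|apply pow_le; lra]. }
  intros z w Hz Hw.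
  assert (HR := cpseries_remainder c z w _ _ _ (HF z ltac:(unfold in_disk; lra))
    (HF w ltac:(unfold in_disk; lra)) (HF' z ltac:(unfold in_disk; lra))).
  assert (HK' : is_series (fun k => Cmod (w - z) ^ 2 * (Cmod (cderive (cderive c) k) * rho ^ k))
    (K * Cmod (w - z) ^ 2)).
  { rewrite Rmult_comm. apply (is_series_scal (V:=R_NormedModule) _ _ _ HK). }
  assert (Hle : forall k, Cmod ((w ^ S (S k) - z ^ S (S k) - RtoC (INR (S (S k))) * z ^ S k * (w - z))
                         * c (S (S k))) <= Cmod (w - z) ^ 2 * (Cmod (cderive (cderive c) k) * rho ^ k)).
  { intros k. rewrite Cmod_mult. unfold cderive.
    rewrite !Cmod_mult, !Cmod_R, !Rabs_pos_eq by apply pos_INR.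
    assert (H := pow_second_order rho z w k Hz Hw).
    assert (H0 := Cmod_ge_0 (c (S (S k)))).
    eapply Rle_trans; [apply Rmult_le_compat_r; [exact H0|exact H]|]. right; ring. }
  exact (Cmod_is_cseries_le _ _ _ _ Hle HR HK').
Qed.

Lemma is_derive_cpseries (c : nat -> C) (F F' : C -> C) (z : C) :
  (forall z, in_disk z -> is_cpseries c z (F z)) ->
  (forall z, in_disk z -> is_cpseries (cderive c) z (F' z)) ->
  in_disk z -> @is_derive C_AbsRing C_NormedModule F z (F' z).
Proof.
  intros HF HF' Hz. unfold in_disk in Hz.
  assert (Hc : disk_coeffs c) by (apply disk_coeffs_of_cv; eauto).
  set (rho := (Cmod z + 1) / 2). assert (Hz0 := Cmod_ge_0 z).
  destruct (cpseries_remainder_le c F F' rho Hc) as [K [HK0 HK]]; auto.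
  { unfold rho; lra. }
  split; [apply is_linear_scal_l|].
  intros x Hx. apply (is_filter_lim_locally_unique (V:=AbsRing_NormedModule C_AbsRing)) in Hx. subst x.
  intros eps.
  assert (Hd : 0 < Rmin (rho - Cmod z) (eps / (K + 1))).
  { apply Rmin_pos; [unfold rho; lra|]. apply Rdiv_lt_0_compat; [apply cond_pos|lra]. }
  apply filter_imp with (2 := locally_ball_norm (V:=AbsRing_NormedModule C_AbsRing) z (mkposreal _ Hd)).
  intros w Hw. unfold ball_norm in Hw. simpl in Hw.
  change (Cmod (w - z) < Rmin (rho - Cmod z) (eps / (K + 1))) in Hw.
  change (Cmod (F w - F z - (w - z) * F' z) <= eps * Cmod (w - z)).
  assert (Hw1 : Cmod (w - z) < rho - Cmod z) by (eapply Rlt_le_trans; [exact Hw|apply Rmin_l]).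
  assert (Hw2 : Cmod (w - z) <= eps / (K + 1))
    by (left; eapply Rlt_le_trans; [exact Hw|apply Rmin_r]).
  rewrite (Cmult_comm (w - z)). eapply Rle_trans; [apply HK|].
  - unfold rho; lra.
  - replace w with (w - z + z)%C at 1 by ring.
    eapply Rle_trans; [apply Cmod_triangle|]. lra.
  - assert (Hq := Cmod_ge_0 (w - z)).
    assert (K * Cmod (w - z) <= eps).
    { apply Rle_trans with ((K + 1) * (eps / (K + 1))).
      - apply Rmult_le_compat; lra.
      - right. field. lra. }
    simpl. rewrite Rmult_1_r, <- Rmult_assoc. now apply Rmult_le_compat_r.
Qed.

(** * Means over roots of unity *)

Notation csum := (@sum_n C_AbelianMonoid).

(** The roots have order n + 1, so that no n has to be excluded. *)
Definition root_of_unity (n j : nat) : C :=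
  (cos (2 * PI * INR j / INR (S n)), sin (2 * PI * INR j / INR (S n))).

Definition roots_mean (n : nat) (phi : C -> R) : R :=
  sum_n (fun j => phi (root_of_unity n j)) n / INR (S n).

Lemma csum_O (u : nat -> C) : csum u 0 = u 0%nat.
Proof. exact (sum_O (G:=C_AbelianMonoid) u). Qed.

Lemma csum_S (u : nat -> C) (n : nat) : csum u (S n) = (csum u n + u (S n))%C.
Proof. exact (sum_Sn (G:=C_AbelianMonoid) u n). Qed.

Lemma rsum_S (u : nat -> R) (n : nat) : sum_n u (S n) = sum_n u n + u (S n).
Proof. exact (sum_Sn (G:=R_AbelianMonoid) u n). Qed.

Lemma csum_plus (u v : nat -> C) (n : nat) :
  csum (fun j => u j + v j)%C n = (csum u n + csum v n)%C.
Proof. exact (sum_n_plus (G:=C_AbelianMonoid) u v n). Qed.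

Lemma csum_mult_l (a : C) (u : nat -> C) (n : nat) :
  csum (fun j => a * u j)%C n = (a * csum u n)%C.
Proof. exact (sum_n_mult_l (K:=C_Ring) a u n). Qed.

Lemma Re_csum (u : nat -> C) (n : nat) : Re (csum u n) = sum_n (fun j => Re (u j)) n.
Proof.
  induction n as [|n IH].
  - now rewrite csum_O, sum_O.
  - rewrite csum_S, rsum_S, <- IH. reflexivity.
Qed.

Lemma csum_geom (q : C) (n : nat) : ((q - 1) * csum (fun j => q ^ j) n = q ^ S n - 1)%C.
Proof.
  induction n as [|n IH].
  - rewrite csum_O. simpl. ring.
  - rewrite csum_S, Cmult_plus_distr_l, IH. simpl. ring.
Qed.

Lemma cos_sin_pow (t : R) (k : nat) :
  ((cos t, sin t) ^ k)%C = (cos (INR k * t), sin (INR k * t)).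
Proof.
  induction k as [|k IH].
  - simpl. now rewrite Rmult_0_l, cos_0, sin_0.
  - rewrite Cpow_S, IH, S_INR, Rmult_plus_distr_r, Rmult_1_l, cos_plus, sin_plus.
    unfold Cmult. simpl. f_equal; ring.
Qed.

Lemma Cmod_root_of_unity (n j : nat) : Cmod (root_of_unity n j) = 1.
Proof.
  unfold Cmod, root_of_unity; simpl.
  rewrite !Rmult_1_r, Rplus_comm.
  change (sqrt (Rsqr (sin (2 * PI * INR j / INR (S n))) + Rsqr (cos (2 * PI * INR j / INR (S n)))) = 1).
  now rewrite sin2_cos2, sqrt_1.
Qed.

Lemma cos_lt_1 (t : R) : 0 < t < 2 * PI -> cos t < 1.
Proof.
  intros Ht. replace t with (2 * (t / 2)) by field. rewrite cos_2a_sin.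
  assert (0 < sin (t / 2)) by (apply sin_gt_0; lra). nra.
Qed.

Lemma roots_sum_Cconj_pow (n m : nat) : (0 < m <= n)%nat ->
  csum (fun j => Cconj (root_of_unity n j) ^ m)%C n = RtoC 0.
Proof.
  intros Hm.
  assert (HS : 0 < INR (S n)) by (apply lt_0_INR; lia).
  assert (HPI := PI_RGT_0).
  set (t := - (2 * PI * INR m / INR (S n))).
  rewrite (sum_n_ext (G:=C_AbelianMonoid) _ (fun j => (cos t, sin t) ^ j)%C).
  2: { intros j. unfold root_of_unity, Cconj; cbn [fst snd].
    rewrite <- sin_neg, <- (cos_neg (2 * PI * INR j / INR (S n))), !cos_sin_pow.
    replace (INR m * - (2 * PI * INR j / INR (S n))) with (INR j * t); [reflexivity|].
    unfold t; field; lra. }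
  assert (H := csum_geom (cos t, sin t) n).
  assert (E1 : ((cos t, sin t) ^ S n = 1)%C).
  { rewrite cos_sin_pow. replace (INR (S n) * t) with (- (0 + 2 * INR m * PI)).
    2: { unfold t; field; lra. }
    rewrite cos_neg, sin_neg, cos_period, sin_period, cos_0, sin_0, Ropp_0. reflexivity. }
  rewrite E1 in H.
  assert (Hq : ((cos t, sin t) - 1 <> 0)%C).
  { intros E0. apply (f_equal Re) in E0. simpl in E0.
    assert (cos t < 1); [|lra].
    unfold t. rewrite cos_neg. apply cos_lt_1.
    assert (0 < INR m) by (apply lt_0_INR; lia).
    assert (INR m < INR (S n)) by (apply lt_INR; lia).
    split.
    - apply Rdiv_lt_0_compat; nra.
    - apply Rmult_lt_reg_r with (INR (S n)); [lra|].
      unfold Rdiv. rewrite Rmult_assoc, Rinv_l by lra. nra. }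
  apply (f_equal (Cmult (/ ((cos t, sin t) - 1)))) in H.
  rewrite Cmult_assoc, Cinv_l, Cmult_1_l in H by exact Hq.
  rewrite H. apply injective_projections; simpl; ring.
Qed.

Lemma Cconj_RtoC (x : R) : Cconj (RtoC x) = RtoC x.
Proof. unfold Cconj, RtoC; simpl; f_equal; ring. Qed.

Lemma roots_sum_orthogonal (n k m : nat) (r : R) : (k < m <= n)%nat ->
  csum (fun j => (RtoC r * root_of_unity n j) ^ k * Cconj (RtoC r * root_of_unity n j) ^ m)%C n = RtoC 0.
Proof.
  intros Hkm.
  rewrite (sum_n_ext (G:=C_AbelianMonoid) _
    (fun j => RtoC (r ^ (k + m)) * Cconj (root_of_unity n j) ^ (m - k))%C).
  - rewrite csum_mult_l, roots_sum_Cconj_pow by lia. apply Cmult_0_r.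
  - intros j. match goal with |- ?a = ?b => change (@eq C a b) end.
    replace m with ((m - k) + k)%nat at 1 by lia.
    set (w := root_of_unity n j).
    assert (Hw : (w * Cconj w = 1)%C).
    { rewrite <- Cmod2_conj. unfold w. rewrite Cmod_root_of_unity. f_equal; ring. }
    rewrite Cmult_conj, Cpow_add_r, !Cpow_mult_l, <- Cpow_mult_l.
    rewrite Cconj_RtoC. replace (k + m)%nat with (k + (m - k) + k)%nat by lia.
    rewrite RtoC_pow, !Cpow_add_r, !Cpow_mult_l.
    transitivity (RtoC r ^ k * RtoC r ^ (m - k) * RtoC r ^ k * Cconj w ^ (m - k) * (w ^ k * Cconj w ^ k))%C;
      [ring|].
    rewrite <- Cpow_mult_l, Hw, Cpow_1_l. ring.
Qed.

(** * Parseval's identity *)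

Lemma Cmod_sqr_plus (u v : C) :
  Cmod (u + v) ^ 2 = Cmod u ^ 2 + 2 * Re (u * Cconj v) + Cmod v ^ 2.
Proof. rewrite !Cmod2_alt. destruct u, v; simpl. ring. Qed.

Lemma roots_mean_ext (n : nat) (phi psi : C -> R) :
  (forall z, Cmod z = 1 -> phi z = psi z) -> roots_mean n phi = roots_mean n psi.
Proof.
  intros H. unfold roots_mean. f_equal. apply (sum_n_ext (G:=R_AbelianMonoid)).
  intros j. apply H, Cmod_root_of_unity.
Qed.

Lemma roots_mean_plus (n : nat) (phi psi : C -> R) :
  roots_mean n (fun z => phi z + psi z) = roots_mean n phi + roots_mean n psi.
Proof.
  unfold roots_mean. unfold Rdiv. rewrite <- Rmult_plus_distr_r. f_equal.
  apply (sum_n_plus (G:=R_AbelianMonoid)).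
Qed.

Lemma roots_mean_scal (n : nat) (x : R) (phi : C -> R) :
  roots_mean n (fun z => x * phi z) = x * roots_mean n phi.
Proof.
  unfold roots_mean, Rdiv. rewrite <- Rmult_assoc. f_equal.
  apply (sum_n_mult_l (K:=R_Ring)).
Qed.

Lemma roots_mean_const (n : nat) (x : R) : roots_mean n (fun _ => x) = x.
Proof.
  unfold roots_mean. rewrite sum_n_const. field. apply not_0_INR. lia.
Qed.

Lemma roots_mean_le (n : nat) (phi psi : C -> R) :
  (forall z, Cmod z = 1 -> phi z <= psi z) -> roots_mean n phi <= roots_mean n psi.
Proof.
  intros H. unfold roots_mean, Rdiv. apply Rmult_le_compat_r.
  - left. apply Rinv_0_lt_compat, lt_0_INR. lia.
  - apply sum_n_m_le. intros j. apply H, Cmod_root_of_unity.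
Qed.

Lemma roots_sum_poly_orthogonal (c : nat -> C) (n k m : nat) (r : R) : (k < m <= n)%nat ->
  csum (fun j => csum (fun i => (RtoC r * root_of_unity n j) ^ i * c i) k
                 * Cconj (RtoC r * root_of_unity n j) ^ m)%C n = RtoC 0.
Proof.
  induction k as [|k IH]; intros Hkm.
  - rewrite (sum_n_ext (G:=C_AbelianMonoid) _ (fun j => c 0%nat *
      ((RtoC r * root_of_unity n j) ^ 0 * Cconj (RtoC r * root_of_unity n j) ^ m))%C).
    + rewrite csum_mult_l, roots_sum_orthogonal by lia. apply Cmult_0_r.
    + intros j. rewrite csum_O. match goal with |- ?a = ?b => change (@eq C a b) end. ring.
  - rewrite (sum_n_ext (G:=C_AbelianMonoid) _ (fun j =>
      csum (fun i => (RtoC r * root_of_unity n j) ^ i * c i) k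
                 * Cconj (RtoC r * root_of_unity n j) ^ m
      + c (S k) * ((RtoC r * root_of_unity n j) ^ S k * Cconj (RtoC r * root_of_unity n j) ^ m))%C).
    + rewrite csum_plus, csum_mult_l, roots_sum_orthogonal, IH by lia.
      rewrite Cmult_0_r. apply Cplus_0_r.
    + intros j. rewrite csum_S. match goal with |- ?a = ?b => change (@eq C a b) end. ring.
Qed.

(** Expanding |P_k + c_(k+1) z^(k+1)|^2, the cross term averages to 0 because there are
    more than k+1 roots of unity. *)
Lemma roots_mean_poly (c : nat -> C) (n k : nat) (r : R) : 0 <= r -> (k <= n)%nat ->
  roots_mean n (fun z => Cmod (csum (fun i => (RtoC r * z) ^ i * c i)%C k) ^ 2) =
  sum_n (fun i => (Cmod (c i) * r ^ i) ^ 2) k.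
Proof.
  intros Hr. induction k as [|k IH]; intros Hk.
  - rewrite sum_O, (roots_mean_ext _ _ (fun _ => (Cmod (c 0%nat) * r ^ 0) ^ 2)).
    + apply roots_mean_const.
    + intros z _. rewrite csum_O, Cmod_mult, Cmod_pow. simpl. ring.
  - rewrite rsum_S, <- IH by lia.
    rewrite (roots_mean_ext _ _ (fun z =>
      (Cmod (csum (fun i => (RtoC r * z) ^ i * c i)%C k) ^ 2 + (Cmod (c (S k)) * r ^ S k) ^ 2) +
      2 * Re (Cconj (c (S k)) * (csum (fun i => (RtoC r * z) ^ i * c i) k * Cconj (RtoC r * z) ^ S k))%C)).
    + rewrite !roots_mean_plus, roots_mean_const, roots_mean_scal.
      replace (roots_mean n (fun z => Re _)) with 0; [lra|].
      unfold roots_mean. rewrite <- (Re_csum (fun j => Cconj (c (S k)) *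
        (csum (fun i => (RtoC r * root_of_unity n j) ^ i * c i) k
                 * Cconj (RtoC r * root_of_unity n j) ^ S k))%C), csum_mult_l.
      rewrite roots_sum_poly_orthogonal by lia.
      rewrite Cmult_0_r. simpl. unfold Rdiv. ring.
    + intros z Hz. rewrite csum_S, Cmod_sqr_plus, Cmod_mult, Cmod_pow, Cmod_mult, Hz.
      rewrite Cmod_R, Rabs_pos_eq by exact Hr.
      rewrite Cmult_conj, Cpow_conj.
      replace (csum (fun i => (RtoC r * z) ^ i * c i) k * (Cconj (RtoC r * z) ^ S k * Cconj (c (S k))))%C
       with (Cconj (c (S k)) * (csum (fun i => (RtoC r * z) ^ i * c i) k * Cconj (RtoC r * z) ^ S k))%C
       by ring.
      rewrite Rmult_1_r. ring.
Qed.

Lemma cpseries_tail_le (c : nat -> C) (z l : C) (T : R) (k : nat) :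
  is_cpseries c z l -> is_series (fun i => Cmod (c i) * Cmod z ^ i) T ->
  Cmod (l - csum (fun i => z ^ i * c i)%C k) <= T - sum_n (fun i => Cmod (c i) * Cmod z ^ i) k.
Proof.
  rewrite is_cpseries_iff. intros Hl HT.
  apply (Cmod_is_cseries_le (fun i => z ^ (S k + i) * c (S k + i)%nat)%C
    (fun i => Cmod (c (S k + i)%nat) * Cmod z ^ (S k + i))).
  - intros i. rewrite Cmod_mult, Cmod_pow. lra.
  - apply (is_series_incr_n (fun i => z ^ i * c i)%C (S k)); [lia|].
    simpl pred.
    refine (eq_ind _ (is_cseries (fun i => z ^ i * c i)%C) Hl _ _).
    match goal with |- _ = plus _ ?s => change (l = (l - s) + s)%C end. ring.
  - apply (is_series_incr_n (fun i => Cmod (c i) * Cmod z ^ i) (S k)); [lia|].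
    simpl pred.
    refine (eq_ind _ (is_series (fun i => Cmod (c i) * Cmod z ^ i)) HT _ _).
    match goal with |- _ = plus _ ?s => change (T = (T - s) + s) end. ring.
Qed.

Lemma sum_n_le_is_series (u : nat -> R) (s : R) (n : nat) :
  (forall k, 0 <= u k) -> is_series u s -> sum_n u n <= s.
Proof.
  intros Hu Hs.
  apply (is_lim_seq_incr_compare (sum_n u) s Hs).
  intros k. rewrite rsum_S. specialize (Hu (S k)). lra.
Qed.

(** On the circle F differs from its n-th partial sum by at most the tail of the series of
    |c_k| r^k, uniformly, while the mean of the squared partial sum over the n+1 roots of
    unity is exact. *)
Lemma parseval (c : nat -> C) (F : C -> C) (r : R) : 0 <= r ->
  ex_series (fun k => Cmod (c k) * r ^ k) ->
  (forall z, Cmod z = r -> is_cpseries c z (F z)) ->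
  ex_series (fun k => (Cmod (c k) * r ^ k) ^ 2) /\
  is_lim_seq (fun n => roots_mean n (fun z => Cmod (F (RtoC r * z)%C) ^ 2))
    (Series (fun k => (Cmod (c k) * r ^ k) ^ 2)).
Proof.
  intros Hr [T HT] HF.
  assert (Hpos : forall k, 0 <= Cmod (c k) * r ^ k).
  { intros k. apply Rmult_le_pos; [apply Cmod_ge_0|now apply pow_le]. }
  set (t := sum_n (fun i => Cmod (c i) * r ^ i)).
  assert (Ht : forall n, 0 <= t n <= T).
  { intros n. split; [|now apply sum_n_le_is_series].
    unfold t. induction n as [|n IH]; [rewrite sum_O; apply Hpos|].
    rewrite rsum_S. specialize (Hpos (S n)). lra. }
  assert (Hterm : forall k, Cmod (c k) * r ^ k <= T).
  { intros [|k].
    - specialize (Ht 0%nat). unfold t in Ht. rewrite sum_O in Ht. lra.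
    - assert (H1 := Ht k). assert (H2 := Ht (S k)). unfold t in *. rewrite rsum_S in H2. lra. }
  assert (Hex : ex_series (fun k => (Cmod (c k) * r ^ k) ^ 2)).
  { apply (ex_series_le (V:=R_CompleteNormedModule)) with (fun k => T * (Cmod (c k) * r ^ k)).
    - intros k. change (Rabs ((Cmod (c k) * r ^ k) ^ 2) <= T * (Cmod (c k) * r ^ k)).
      rewrite Rabs_pos_eq by apply pow2_ge_0. simpl. rewrite Rmult_1_r.
      now apply Rmult_le_compat_r.
    - apply (ex_series_scal (V:=R_NormedModule)). now exists T. }
  split; [exact Hex|].
  (* ||F|^2 - |P|^2| = ||F| - |P|| (|F| + |P|), where both moduli are at most T *)
  assert (Herr : forall n, - (2 * T * (T - t n)) <=
    roots_mean n (fun z => Cmod (F (RtoC r * z)%C) ^ 2) - sum_n (fun k => (Cmod (c k) * r ^ k) ^ 2) n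
     <= 2 * T * (T - t n)).
  { intros n.
    rewrite <- (roots_mean_poly c n n r Hr) by lia.
    assert (Hpt : forall z, Cmod z = 1 ->
      - (2 * T * (T - t n)) <=
        Cmod (F (RtoC r * z)%C) ^ 2 - Cmod (csum (fun i => (RtoC r * z) ^ i * c i)%C n) ^ 2
        <= 2 * T * (T - t n)).
    { intros z Hz. set (w := (RtoC r * z)%C).
      assert (Hw : Cmod w = r).
      { unfold w. rewrite Cmod_mult, Hz, Cmod_R, Rabs_pos_eq; lra. }
      set (P := csum (fun i => w ^ i * c i)%C n).
      assert (H1 : Cmod (F w - P) <= T - t n).
      { unfold P, t. rewrite <- Hw. apply cpseries_tail_le; [now apply HF|now rewrite Hw]. }
      assert (H2 : Cmod (F w) <= T).
      { apply (Cmod_is_cseries_le (fun i => w ^ i * c i)%C (fun i => Cmod (c i) * r ^ i)); trivial.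
        - intros i. rewrite Cmod_mult, Cmod_pow, Hw. lra.
        - apply is_cpseries_iff. now apply HF. }
      assert (H3 : Cmod P <= T).
      { apply Rle_trans with (t n); [|apply Ht].
        eapply Rle_trans; [exact (norm_sum_n_m (V:=C_NormedModule) _ 0 n)|].
        apply sum_n_m_le. intros i.
        change (Cmod (w ^ i * c i) <= Cmod (c i) * r ^ i). rewrite Cmod_mult, Cmod_pow, Hw. lra. }
      assert (H4 : Cmod (F w) <= Cmod P + Cmod (F w - P)).
      { replace (F w) with (P + (F w - P))%C at 1 by ring. apply Cmod_triangle. }
      assert (H5 : Cmod P <= Cmod (F w) + Cmod (F w - P)).
      { rewrite <- (Cmod_opp (F w - P)).
        replace P with (F w + - (F w - P))%C at 1 by ring. apply Cmod_triangle. }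
      assert (H6 := Cmod_ge_0 P). assert (H7 := Cmod_ge_0 (F w)).
      assert (H8 : - (T - t n) <= Cmod (F w) - Cmod P <= T - t n) by lra.
      replace (Cmod (F w) ^ 2 - Cmod P ^ 2) with ((Cmod (F w) - Cmod P) * (Cmod (F w) + Cmod P)) by ring.
      assert (H9 : 0 <= T - t n) by (specialize (Ht n); lra).
      split; nra. }
    split.
    - apply Rplus_le_reg_r with (roots_mean n (fun z => Cmod (csum (fun i => (RtoC r * z) ^ i * c i)%C n) ^ 2)).
      ring_simplify (roots_mean n (fun z => Cmod (F (RtoC r * z)%C) ^ 2) -
        roots_mean n (fun z => Cmod (csum (fun i => (RtoC r * z) ^ i * c i)%C n) ^ 2) +
        roots_mean n (fun z => Cmod (csum (fun i => (RtoC r * z) ^ i * c i)%C n) ^ 2)).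
      rewrite <- (roots_mean_const n (- (2 * T * (T - t n)))), <- roots_mean_plus.
      apply roots_mean_le. intros z Hz. specialize (Hpt z Hz). lra.
    - apply Rplus_le_reg_r with (roots_mean n (fun z => Cmod (csum (fun i => (RtoC r * z) ^ i * c i)%C n) ^ 2)).
      ring_simplify (roots_mean n (fun z => Cmod (F (RtoC r * z)%C) ^ 2) -
        roots_mean n (fun z => Cmod (csum (fun i => (RtoC r * z) ^ i * c i)%C n) ^ 2) +
        roots_mean n (fun z => Cmod (csum (fun i => (RtoC r * z) ^ i * c i)%C n) ^ 2)).
      rewrite <- (roots_mean_const n (2 * T * (T - t n))), <- roots_mean_plus.
      apply roots_mean_le. intros z Hz. specialize (Hpt z Hz). lra. }
  set (Sq := sum_n (fun k => (Cmod (c k) * r ^ k) ^ 2)) in *.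
  assert (HSq : is_lim_seq Sq (Series (fun k => (Cmod (c k) * r ^ k) ^ 2))).
  { exact (Series_correct _ Hex). }
  assert (Htl : is_lim_seq (fun n => 2 * T * (T - t n)) 0).
  { replace 0 with (2 * T * (T - T)) by ring.
    apply (is_lim_seq_scal_l (fun n => T - t n) (2 * T) (T - T)).
    apply is_lim_seq_minus'; [apply is_lim_seq_const|exact HT]. }
  set (L := Series _) in *.
  apply is_lim_seq_le_le with (u := fun n => Sq n - 2 * T * (T - t n))
    (w := fun n => Sq n + 2 * T * (T - t n)).
  - intros n. specialize (Herr n). lra.
  - replace L with (L - 0) by ring. now apply is_lim_seq_minus'.
  - replace L with (L + 0) by ring. now apply is_lim_seq_plus'.
Qed.

(** * Coefficient comparison and coefficient bounds *)

(** Identity theorem with vanishing known only on the right of 0: the constant term is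
    the limit at 0, and one may then divide by x and repeat.  The one-sided form is needed
    because Parseval only gives access to x = r^2. *)
Lemma pseries_zero_right (d : nat -> R) :
  (forall x, 0 < x < 1 -> is_pseries d x 0) -> forall n, d n = 0.
Proof.
  intros H n. revert d H.
  assert (H0 : forall d : nat -> R, (forall x, 0 < x < 1 -> is_pseries d x 0) -> d 0%nat = 0).
  { intros d H.
    assert (Hr : Rbar_lt 0 (CV_radius d)).
    { apply Rbar_not_le_lt. intros Hle.
      apply (CV_disk_outside d (1 / 2)).
      - eapply Rbar_le_lt_trans; [exact Hle|]. simpl. rewrite Rabs_pos_eq; lra.
      - apply ex_series_lim_0. exists 0. apply is_pseries_R. apply H. lra. }
    assert (Hc : continuity_pt (PSeries d) 0).
    { apply PSeries_continuity. now rewrite Rabs_R0. }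
    rewrite <- PSeries_0.
    assert (Hl : is_lim_seq (fun k => / (INR k + 2)) 0).
    { replace (Finite 0) with (Rbar_inv p_infty) by reflexivity.
      apply is_lim_seq_inv; [|easy].
      eapply is_lim_seq_plus; [apply is_lim_seq_INR|apply is_lim_seq_const|reflexivity]. }
    assert (Hl' := is_lim_seq_continuous _ _ _ Hc Hl).
    assert (E : is_lim_seq (fun k => PSeries d (/ (INR k + 2))) 0).
    { apply is_lim_seq_ext with (fun _ => 0); [|apply is_lim_seq_const].
      intros k. symmetry. apply is_pseries_unique, H.
      assert (Hk := pos_INR k). split; [apply Rinv_0_lt_compat; lra|].
      rewrite <- Rinv_1. apply Rinv_lt_contravar; lra. }
    apply is_lim_seq_unique in E. apply is_lim_seq_unique in Hl'. congruence. }
  induction n as [|n IH]; intros d H; [now apply H0|].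
  apply (IH (PS_decr_1 d)). intros x Hx.
  assert (Hinv : / x * x = 1) by (field; lra).
  assert (HD := is_pseries_decr_1 (V:=R_NormedModule) d x (/ x) 0 Hinv (H x Hx)).
  refine (eq_ind _ (is_pseries (V:=R_NormedModule) (PS_decr_1 d) x) HD _ _).
  rewrite (H0 d H). change (/ x * (0 + - 0) = 0). ring.
Qed.

Lemma in_disk_lt1 (z : C) (r : R) : Cmod z = r -> r < 1 -> in_disk z.
Proof. intros <- H. exact H. Qed.

Lemma Cmod_coeff_eq (G H : C -> C) (a b : nat -> C) :
  (forall z, in_disk z -> is_cpseries a z (G z)) ->
  (forall z, in_disk z -> is_cpseries b z (H z)) ->
  (forall z, in_disk z -> Cmod (G z) = Cmod (H z)) ->
  forall k, Cmod (a k) = Cmod (b k).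
Proof.
  intros HG HH Heq k.
  assert (Ha : disk_coeffs a) by (apply disk_coeffs_of_cv; eauto).
  assert (Hb : disk_coeffs b) by (apply disk_coeffs_of_cv; eauto).
  assert (E : Cmod (a k) ^ 2 - Cmod (b k) ^ 2 = 0).
  { apply (pseries_zero_right (fun k => Cmod (a k) ^ 2 - Cmod (b k) ^ 2)). clear k.
    intros x Hx.
    set (r := sqrt x).
    assert (Hr0 : 0 <= r) by apply sqrt_pos.
    assert (Hr1 : r < 1) by (unfold r; rewrite <- sqrt_1; apply sqrt_lt_1; lra).
    assert (Hrx : r ^ 2 = x) by (unfold r; apply pow2_sqrt; lra).
    destruct (parseval a G r Hr0) as [Ea La].
    { apply Ha; lra. } { intros z Hz. apply HG. eapply in_disk_lt1; eauto. }
    destruct (parseval b H r Hr0) as [Eb Lb].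
    { apply Hb; lra. } { intros z Hz. apply HH. eapply in_disk_lt1; eauto. }
    assert (ES : Series (fun k => (Cmod (a k) * r ^ k) ^ 2) = Series (fun k => (Cmod (b k) * r ^ k) ^ 2)).
    { apply is_lim_seq_unique in La. apply is_lim_seq_unique in Lb.
      rewrite (Lim_seq_ext _ (fun n => roots_mean n (fun z => Cmod (H (RtoC r * z)%C) ^ 2))) in La.
      - congruence.
      - intros n. apply roots_mean_ext. intros z Hz. rewrite Heq; [reflexivity|].
        unfold in_disk. rewrite Cmod_mult, Hz, Cmod_R, Rabs_pos_eq; lra. }
    apply is_pseries_R.
    apply is_series_ext with (fun k => (Cmod (a k) * r ^ k) ^ 2 - (Cmod (b k) * r ^ k) ^ 2).
    { intros n. rewrite <- Hrx, <- pow_mult, (Nat.mul_comm 2), pow_mult.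
      match goal with |- ?u = ?v => change (@eq R u v) end. ring. }
    assert (HS := is_series_minus _ _ _ _ (Series_correct _ Ea) (Series_correct _ Eb)).
    rewrite ES in HS.
    refine (eq_ind _ (is_series _) HS _ _). apply Rplus_opp_r. }
  apply Rsqr_inj; try apply Cmod_ge_0. unfold Rsqr. lra.
Qed.

Lemma roots_mean_binomial (n N : nat) (x y : C) (r : R) : 0 <= r -> (0 < n <= N)%nat ->
  roots_mean N (fun z => Cmod (x + y * (RtoC r * z) ^ n)%C ^ 2) = Cmod x ^ 2 + (Cmod y * r ^ n) ^ 2.
Proof.
  intros Hr Hn.
  rewrite (roots_mean_ext _ _ (fun z => (Cmod x ^ 2 + (Cmod y * r ^ n) ^ 2)
    + 2 * Re (x * Cconj y * RtoC (r ^ n) * Cconj z ^ n)%C)).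
  - rewrite roots_mean_plus, roots_mean_const, roots_mean_scal.
    replace (roots_mean N (fun z => Re _)) with 0; [lra|].
    unfold roots_mean. rewrite <- (Re_csum (fun j => x * Cconj y * RtoC (r ^ n) * Cconj (root_of_unity N j) ^ n)%C).
    rewrite csum_mult_l, roots_sum_Cconj_pow by lia.
    rewrite Cmult_0_r. simpl. unfold Rdiv. ring.
  - intros z Hz. rewrite Cmod_sqr_plus, !Cmod_mult, Cmod_pow, Cmod_mult, Hz, Cmod_R, Rabs_pos_eq, Rmult_1_r by exact Hr.
    replace (x * Cconj (y * (RtoC r * z) ^ n))%C with (x * Cconj y * RtoC (r ^ n) * Cconj z ^ n)%C; [ring|].
    rewrite Cmult_conj, Cpow_conj, Cmult_conj, Cpow_mult_l, RtoC_pow.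
    rewrite Cconj_RtoC. ring.
Qed.

Lemma le_of_pow_lt1 (u v : R) (m : nat) :
  (forall r, 0 < r < 1 -> u * r ^ m <= v) -> u <= v.
Proof.
  intros H.
  assert (Hl : is_lim_seq (fun k => u * (1 - / (INR k + 2)) ^ m) (u * (1 - 0) ^ m)).
  { apply (is_lim_seq_continuous (fun t => u * (1 - t) ^ m) (fun k => / (INR k + 2)) 0).
    - reg.
    - replace (Finite 0) with (Rbar_inv p_infty) by reflexivity.
      apply is_lim_seq_inv; [|easy].
      eapply is_lim_seq_plus; [apply is_lim_seq_INR|apply is_lim_seq_const|reflexivity]. }
  rewrite Rminus_0_r, pow1, Rmult_1_r in Hl.
  apply (is_lim_seq_le _ (fun _ => v) u v) with (2 := Hl); [|apply is_lim_seq_const].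
  intros k. apply H. assert (Hk := pos_INR k).
  assert (0 < / (INR k + 2)) by (apply Rinv_0_lt_compat; lra).
  assert (/ (INR k + 2) < 1) by (rewrite <- Rinv_1; apply Rinv_lt_contravar; lra).
  lra.
Qed.

Lemma first_le_sum_n (u : nat -> R) (n : nat) : (forall k, 0 <= u k) -> u 0%nat <= sum_n u n.
Proof.
  intros Hu. induction n as [|n IH]; [rewrite sum_O; apply Rle_refl|].
  rewrite rsum_S. specialize (Hu (S n)). lra.
Qed.

(** On a circle of radius r < 1 the mean of |h(z) (x + y z^n)|^2 is at most that of
    |x + y z^n|^2, which is at most |x|^2 + |y|^2; by Parseval it is at least the contribution
    of the coefficients of 1 and z^n.  Then r tends to 1. *)
Lemma bessel_two_coeffs (h : C -> C) (a : nat -> C) (n : nat) (x y : C) :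
  (forall z, in_disk z -> is_cpseries a z (h z)) ->
  (forall z, in_disk z -> Cmod (h z) <= 1) ->
  (0 < n)%nat ->
  Cmod (x * a 0%nat) ^ 2 + Cmod (x * a n + y * a 0%nat) ^ 2 <= Cmod x ^ 2 + Cmod y ^ 2.
Proof.
  intros Hh Hb Hn.
  set (c := PS_plus (V:=C_NormedModule) (PS_scal (V:=C_NormedModule) x a)
     (PS_scal (V:=C_NormedModule) y (PS_incr_n (V:=C_NormedModule) a n))).
  set (F := fun z => (x * h z + y * (z ^ n * h z))%C).
  assert (HF : forall z, in_disk z -> is_cpseries c z (F z)).
  { intros z Hz. apply (is_pseries_plus (V:=C_NormedModule)).
    - apply (is_pseries_scal (V:=C_NormedModule)); [apply Cmult_comm|]. now apply Hh.
    - apply (is_pseries_scal (V:=C_NormedModule)); [apply Cmult_comm|].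
      rewrite <- pow_n_Cpow. apply (is_pseries_incr_n (V:=C_NormedModule)). now apply Hh. }
  assert (Hc : disk_coeffs c) by (apply disk_coeffs_of_cv; eauto).
  assert (Hc0 : c 0%nat = (x * a 0%nat)%C).
  { unfold c, PS_plus, PS_scal. destruct n as [|n]; [lia|].
    change (x * a 0%nat + y * 0 = x * a 0%nat)%C. ring. }
  assert (Hcn : c n = (x * a n + y * a 0%nat)%C).
  { unfold c, PS_plus, PS_scal. rewrite PS_incr_n_simplify.
    destruct (Compare_dec.le_lt_dec n n); [|lia]. rewrite Nat.sub_diag. reflexivity. }
  rewrite <- Hc0, <- Hcn.
  enough (Cmod (c n) ^ 2 <= Cmod x ^ 2 + Cmod y ^ 2 - Cmod (c 0%nat) ^ 2) by lra.
  (* it suffices to prove the bound with the factor r^(2n) that Parseval carries *)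
  apply le_of_pow_lt1 with (m := (n * 2)%nat). intros r Hr.
  destruct (parseval c F r) as [Ex HL]; [lra|apply Hc; lra| |].
  { intros z Hz. apply HF. eapply in_disk_lt1; [exact Hz|lra]. }
  set (u := fun k => (Cmod (c k) * r ^ k) ^ 2) in *.
  assert (H1 : Series u <= Cmod x ^ 2 + (Cmod y * r ^ n) ^ 2).
  { apply (is_lim_seq_le_loc _ (fun _ => Cmod x ^ 2 + (Cmod y * r ^ n) ^ 2)
      (Finite (Series u)) (Finite (Cmod x ^ 2 + (Cmod y * r ^ n) ^ 2))) with (2 := HL);
      [|apply is_lim_seq_const].
    exists n. intros N HN. rewrite <- (roots_mean_binomial n N) by (lra || lia).
    apply roots_mean_le. intros z Hz. apply pow_incr. split; [apply Cmod_ge_0|].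
    unfold F. set (w := (RtoC r * z)%C).
    replace (x * h w + y * (w ^ n * h w))%C with ((x + y * w ^ n) * h w)%C by ring.
    rewrite Cmod_mult.
    assert (Hw : Cmod (h w) <= 1).
    { apply Hb. unfold in_disk, w. rewrite Cmod_mult, Hz, Cmod_R, Rabs_pos_eq; lra. }
    assert (H0 := Cmod_ge_0 (x + y * w ^ n)). assert (H0' := Cmod_ge_0 (h w)). nra. }
  assert (Hupos : forall k, 0 <= u k) by (intros k; apply pow2_ge_0).
  assert (H2 : u 0%nat + u n <= Series u).
  { apply Rle_trans with (sum_n u n); [|apply sum_n_le_is_series; [exact Hupos|now apply Series_correct]].
    destruct n as [|m]; [inversion Hn|]. rewrite rsum_S. apply Rplus_le_compat_r.
    now apply first_le_sum_n. }
  assert (H3 : (Cmod y * r ^ n) ^ 2 <= Cmod y ^ 2).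
  { assert (Hy := Cmod_ge_0 y).
    assert (0 <= r ^ n <= 1).
    { split; [apply pow_le; lra|]. rewrite <- (pow1 n). apply pow_incr. lra. }
    apply pow_incr. split; nra. }
  unfold u in H2 at 1 2. rewrite pow_O in H2. rewrite pow_mult. nra.
Qed.

(** The optimal test vector in [bessel_two_coeffs] has components proportional to
    (1 - A^2) a_0 and A^2 a_n with A = |a_0|: the two terms of the second coefficient are
    then aligned.  It degenerates when A = 0 or A = 1, where x = 1, y = 0 suffices. *)
Lemma bounded_coeff_le (h : C -> C) (a : nat -> C) (n : nat) :
  (forall z, in_disk z -> is_cpseries a z (h z)) ->
  (forall z, in_disk z -> Cmod (h z) <= 1) ->
  (0 < n)%nat ->
  Cmod (a n) <= 1 - Cmod (a 0%nat) ^ 2.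
Proof.
  intros Hh Hb Hn.
  assert (HA := Cmod_ge_0 (a 0%nat)). assert (HB := Cmod_ge_0 (a n)).
  set (A := Cmod (a 0%nat)) in *. set (B := Cmod (a n)) in *.
  assert (H1 := bessel_two_coeffs h a n (RtoC 1) (RtoC 0) Hh Hb Hn).
  replace (1 * a n + 0 * a 0%nat)%C with (a n) in H1 by ring.
  rewrite Cmult_1_l, Cmod_1, Cmod_0 in H1. fold A B in H1.
  assert (H2 := bessel_two_coeffs h a n (RtoC (1 - A ^ 2) * a 0%nat)%C (RtoC (A ^ 2) * a n)%C Hh Hb Hn).
  replace (RtoC (1 - A ^ 2) * a 0%nat * a n + RtoC (A ^ 2) * a n * a 0%nat)%C
    with (a 0%nat * a n)%C in H2 by (rewrite RtoC_minus; ring).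
  assert (HA1 : A <= 1) by nra.
  assert (HA2 : 0 <= 1 - A ^ 2) by nra.
  rewrite !Cmod_mult, !Cmod_R, (Rabs_pos_eq (1 - A ^ 2)), (Rabs_pos_eq (A ^ 2)) in H2 by nra.
  fold A B in H2.
  destruct (Req_dec A 0) as [E|E]; [rewrite E in *; nra|].
  destruct (Req_dec A 1) as [E1|E1]; [rewrite E1 in *; nra|].
  set (D := 1 - A ^ 2) in *.
  assert (HD : 0 < D) by (unfold D; nra).
  assert (H3 : (A ^ 2 * D) * B ^ 2 <= (A ^ 2 * D) * D ^ 2).
  { unfold D in H2 |- *. clear - H2. lra. }
  apply Rmult_le_reg_l in H3; [|apply Rmult_lt_0_compat; [nra|exact HD]].
  apply Rsqr_incr_0_var; [|now left]. rewrite !Rsqr_pow2. exact H3.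
Qed.

(** * The majorant series and the radius *)

Lemma is_series_neg_ln (x : R) : 0 <= x < 1 ->
  is_series (fun k => x ^ S k / INR (S k)) (- ln (1 - x)).
Proof.
  intros Hx.
  set (one := fun _ : nat => 1).
  assert (Hsum : forall t, 0 <= t < 1 -> is_series (fun k => one k * t ^ k) (/ (1 - t))).
  { intros t Ht. apply is_series_ext with (fun k => t ^ k).
    - intros k. unfold one. symmetry. apply Rmult_1_l.
    - apply is_series_geom. rewrite Rabs_pos_eq; lra. }
  assert (Hrad : Rbar_lt (Rabs x) (CV_radius one)).
  { rewrite Rabs_pos_eq by lra. apply Rbar_not_le_lt. intros Hle.
    apply (CV_disk_outside one ((x + 1) / 2)).
    - eapply Rbar_le_lt_trans; [exact Hle|]. simpl. rewrite Rabs_pos_eq; lra.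
    - apply ex_series_lim_0. eexists. apply Hsum. lra. }
  assert (HP := is_pseries_RInt one x Hrad).
  assert (HI : RInt (PSeries one) 0 x = - ln (1 - x)).
  { rewrite (RInt_ext _ (fun t => / (1 - t))).
    - assert (E : - ln (1 - x) = minus (- ln (1 - x)) (- ln (1 - 0))).
      { change (- ln (1 - x) = - ln (1 - x) - - ln (1 - 0)). rewrite Rminus_0_r, ln_1. ring. }
      rewrite E. apply is_RInt_unique.
      apply (is_RInt_derive (fun t => - ln (1 - t))); intros t Ht;
        rewrite Rmin_left, Rmax_right in Ht by lra.
      + auto_derive; [lra|field; lra].
      + apply (ex_derive_continuous (V:=R_NormedModule)). auto_derive. lra.
    - intros t Ht. rewrite Rmin_left, Rmax_right in Ht by lra.
      apply is_pseries_unique, is_pseries_R, Hsum. lra. }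
  rewrite HI in HP. apply is_pseries_R in HP.
  assert (HS := is_series_incr_1 (fun k => PS_Int one k * x ^ k) (- ln (1 - x))).
  assert (HS' : is_series (fun k => PS_Int one (S k) * x ^ S k) (- ln (1 - x))).
  { apply HS. refine (eq_ind _ (is_series _) HP _ _).
    change (- ln (1 - x) = - ln (1 - x) + 0 * 1). ring. }
  apply is_series_ext with (2 := HS'). intros k. unfold PS_Int, one.
  match goal with |- ?u = ?v => change (@eq R u v) end.
  unfold Rdiv. ring.
Qed.

(** The tail is bounded by a geometric series, dropping the denominators. *)
Lemma neg_ln_bounds (x : R) (n : nat) : 0 <= x < 1 ->
  sum_n (fun k => x ^ S k / INR (S k)) n <= - ln (1 - x)
    <= sum_n (fun k => x ^ S k / INR (S k)) n + x ^ S (S n) / (1 - x).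
Proof.
  intros Hx. assert (HS := is_series_neg_ln x Hx).
  set (u := fun k => x ^ S k / INR (S k)) in *.
  assert (Hu : forall k, 0 <= u k <= x ^ S k).
  { intros k. unfold u. assert (0 <= x ^ S k) by (apply pow_le; lra).
    assert (Hk : 1 <= INR (S k)) by (apply (le_INR 1); lia).
    assert (0 < / INR (S k)) by (apply Rinv_0_lt_compat; lra).
    assert (/ INR (S k) <= 1) by (rewrite <- Rinv_1; apply Rinv_le_contravar; lra).
    unfold Rdiv. split; nra. }
  split; [apply sum_n_le_is_series; [apply Hu|exact HS]|].
  assert (HT : is_series (fun k => u (S n + k)%nat) (- ln (1 - x) - sum_n u n)).
  { apply (is_series_incr_n u (S n)); [lia|]. simpl pred.
    refine (eq_ind _ (is_series u) HS _ _).
    match goal with |- _ = plus _ ?s => change (- ln (1 - x) = (- ln (1 - x) - s) + s) end. ring. }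
  assert (HG : is_series (fun k => x ^ S (S n) * x ^ k) (x ^ S (S n) * / (1 - x))).
  { apply (is_series_scal (V:=R_NormedModule)). apply is_series_geom. rewrite Rabs_pos_eq; lra. }
  assert (Hle : - ln (1 - x) - sum_n u n <= x ^ S (S n) * / (1 - x)).
  { rewrite <- (is_series_unique _ _ HT), <- (is_series_unique _ _ HG).
    apply Series_le; [|eexists; exact HG]. intros k. split; [apply Hu|].
    rewrite <- pow_add. apply (Hu (S n + k)%nat). }
  unfold Rdiv. lra.
Qed.

Definition bohr_fun (x : R) : R := 5 * x + 2 * (1 - x) * ln (1 - x).

(** With u = 1 - x and v = 1 - y, the inequality log t <= t - 1 at t = u/v and log u <= 0
    give v log v - u log u >= - (u - v), and 5 (u - v) outweighs twice this loss. *)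
Lemma bohr_fun_incr (x y : R) : 0 <= x -> x < y -> y < 1 -> bohr_fun x < bohr_fun y.
Proof.
  intros Hx Hxy Hy. unfold bohr_fun.
  set (u := 1 - x). set (v := 1 - y).
  assert (Hln : forall t, 0 < t -> ln t <= t - 1).
  { intros t Ht. rewrite <- (ln_exp (t - 1)). apply ln_le; [exact Ht|].
    replace t with (1 + (t - 1)) at 1 by ring. apply exp_ineq1_le. }
  assert (Hu := Hln u ltac:(unfold u; lra)).
  assert (Huv := Hln (u / v) ltac:(apply Rdiv_lt_0_compat; unfold u, v; lra)).
  rewrite ln_div in Huv by (unfold u, v; lra).
  assert (Hv : v * (ln u - ln v) <= v * (u / v - 1)).
  { apply Rmult_le_compat_l; [unfold v; lra|exact Huv]. }
  replace (v * (u / v - 1)) with (u - v) in Hv by (field; unfold v; lra).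
  assert (Hu0 : (u - v) * ln u <= 0).
  { assert (0 < u - v) by (unfold u, v; lra). assert (ln u <= 0) by (unfold u in *; lra). nra. }
  replace x with (1 - u) by (unfold u; ring). replace y with (1 - v) by (unfold v; ring).
  assert (0 < u - v) by (unfold u, v; lra). nra.
Qed.

(** The margin is about 2.8e-7; thirteen terms of the series leave an error below 7e-8 on
    the logarithm. *)
Lemma bohr_fun_at_lower : bohr_fun 0.2998235 < 1.
Proof.
  assert (H := proj1 (neg_ln_bounds 0.2998235 12 ltac:(lra))).
  rewrite !rsum_S, sum_O in H. simpl INR in H. unfold bohr_fun.
  lra.
Qed.

Lemma bohr_fun_at_upper : 1 < bohr_fun 0.2998245.
Proof.
  assert (H := proj2 (neg_ln_bounds 0.2998245 12 ltac:(lra))).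
  rewrite !rsum_S, sum_O in H. simpl INR in H. unfold bohr_fun.
  lra.
Qed.

Lemma bohr_radius_exists :
  exists r0, 0.2998235 < r0 < 0.2998245 /\ bohr_fun r0 = 1.
Proof.
  destruct (IVT_interv (fun x => bohr_fun x - 1) 0.2998235 0.2998245) as [r0 [Hr0 E]].
  - intros t Ht. apply derivable_continuous_pt, ex_derive_Reals_0.
    unfold bohr_fun. auto_derive. lra.
  - lra.
  - assert (H := bohr_fun_at_lower). lra.
  - assert (H := bohr_fun_at_upper). lra.
  - assert (H1 := bohr_fun_at_lower). assert (H2 := bohr_fun_at_upper).
    exists r0. split; [|lra].
    destruct Hr0 as [[Hl|El] [Hu|Eu]]; subst; lra.
Qed.

Lemma ratio_bounds (k : nat) : 0 <= INR k / INR (S k) <= 1.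
Proof.
  assert (Hk := pos_INR k). assert (HS : 0 < INR (S k)) by (apply lt_0_INR; lia). split.
  - apply Rmult_le_pos; [lra|]. left. now apply Rinv_0_lt_compat.
  - apply Rmult_le_reg_r with (INR (S k)); [lra|]. unfold Rdiv.
    rewrite Rmult_assoc, Rinv_l, S_INR by lra. lra.
Qed.

(** When |a_n| <= M for n >= 1 and |b_(k+1)| = (k/(k+1)) |a_k|, the sum
    |a_(k+1)| + |b_(k+1)| is at most M times this weight. *)
Definition bohr_weight (k : nat) : R := 1 + INR k / INR (S k).

Definition bohr_majorant (r : R) : R := 2 * r / (1 - r) + ln (1 - r).

Lemma is_series_bohr_majorant (r : R) : 0 <= r < 1 ->
  is_series (fun k => bohr_weight k * r ^ S k) (bohr_majorant r).
Proof.
  intros Hr.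
  assert (HL := is_series_neg_ln r Hr).
  assert (HG : is_series (fun k => 2 * r * r ^ k) (2 * r * / (1 - r))).
  { apply (is_series_scal (V:=R_NormedModule)). apply is_series_geom. rewrite Rabs_pos_eq; lra. }
  assert (H := is_series_minus _ _ _ _ HG HL).
  replace (bohr_majorant r) with (minus (2 * r * / (1 - r)) (- ln (1 - r))).
  2: { change (2 * r * / (1 - r) - - ln (1 - r) = bohr_majorant r). unfold bohr_majorant, Rdiv. ring. }
  apply is_series_ext with (2 := H). intros k.
  change (2 * r * r ^ k - r ^ S k / INR (S k) = bohr_weight k * r ^ S k).
  unfold bohr_weight. rewrite S_INR. simpl. field. assert (Hk := pos_INR k). lra.
Qed.

Lemma bohr_majorant_fun (r : R) : r < 1 ->
  2 * bohr_majorant r - 1 = (bohr_fun r - 1) / (1 - r).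
Proof. intros Hr. unfold bohr_majorant, bohr_fun. field. lra. Qed.

(** * The inequality *)

(** A choice of sum, meaningful only at points where the series converges. *)
Definition cpseries_sum (c : nat -> C) (z : C) : C :=
  iota (T:=C_CompleteNormedModule) (is_cpseries c z).

Lemma cpseries_sum_correct (c : nat -> C) (z : C) :
  disk_coeffs c -> in_disk z -> is_cpseries c z (cpseries_sum c z).
Proof.
  intros Hc Hz. apply (iota_correct (V:=C_CompleteNormedModule) (is_cpseries c z)).
  destruct (disk_coeffs_cv c z Hc Hz) as [l Hl]. exists l. split; [exact Hl|].
  intros l' Hl'. rewrite is_cpseries_iff in Hl, Hl'. exact (is_cseries_unique _ _ _ Hl Hl').
Qed.

Lemma is_derive_cpseries_sum (c : nat -> C) (F : C -> C) (z : C) :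
  (forall z, in_disk z -> is_cpseries c z (F z)) -> in_disk z ->
  @is_derive C_AbsRing C_NormedModule F z (cpseries_sum (cderive c) z).
Proof.
  intros HF Hz. apply (is_derive_cpseries c F (cpseries_sum (cderive c))); auto.
  intros w Hw. apply cpseries_sum_correct; [|exact Hw].
  apply disk_coeffs_cderive, disk_coeffs_of_cv. eauto.
Qed.

Lemma C_derive_cpseries (c : nat -> C) (F : C -> C) (z : C) :
  (forall z, in_disk z -> is_cpseries c z (F z)) -> in_disk z ->
  is_cpseries (cderive c) z (C_derive F z).
Proof.
  intros HF Hz.
  rewrite (is_C_derive_unique F z _ (is_derive_cpseries_sum c F z HF Hz)).
  apply cpseries_sum_correct; [|exact Hz].
  apply disk_coeffs_cderive, disk_coeffs_of_cv. eauto.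
Qed.

(** The coefficients of g' are (k+1) b_(k+1), those of z h' are k a_k, and the two
    functions have the same modulus. *)
Lemma bohr_class_coeff (f h g : C -> C) (a b : nat -> C) (k : nat) :
  harmonic_bohr_class f h g a b -> Cmod (b (S k)) = INR k / INR (S k) * Cmod (a k).
Proof.
  intros H.
  assert (E := Cmod_coeff_eq (C_derive g) (fun z => z * C_derive h z)%C
    (cderive b) (PS_incr_1 (V:=C_NormedModule) (cderive a))).
  specialize (E (fun z Hz => C_derive_cpseries b g z (hb_g_series _ _ _ _ _ H) Hz)).
  specialize (E (fun z Hz => is_pseries_incr_1 (V:=C_NormedModule) _ _ _
    (C_derive_cpseries a h z (hb_h_series _ _ _ _ _ H) Hz))).
  specialize (E (hb_dilatation _ _ _ _ _ H) k).
  assert (HS : 0 < INR (S k)) by (apply lt_0_INR; lia).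
  unfold cderive in E at 1. rewrite Cmod_mult, Cmod_R, Rabs_pos_eq in E by lra.
  apply Rmult_eq_reg_l with (INR (S k)); [|lra]. rewrite E.
  destruct k as [|k].
  - change (Cmod 0 = INR 1 * (0 / INR 1 * Cmod (a 0%nat))). rewrite Cmod_0. simpl. field.
  - change (Cmod (RtoC (INR (S k)) * a (S k)) = INR (S (S k)) * (INR (S k) / INR (S (S k)) * Cmod (a (S k)))).
    rewrite Cmod_mult, Cmod_R, Rabs_pos_eq by apply pos_INR. field. lra.
Qed.

Lemma bohr_class_inequality (f h g : C -> C) (a b : nat -> C) (r : R) :
  harmonic_bohr_class f h g a b -> 0 <= r < 1 -> bohr_fun r <= 1 -> bohr_inequality a b r.
Proof.
  intros H Hr Hphi.
  set (A := Cmod (a 0%nat)). set (M := 1 - A ^ 2).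
  assert (Hle : forall n, (0 < n)%nat -> Cmod (a n) <= M).
  { intros n Hn. apply (bounded_coeff_le h); auto; [apply (hb_h_series _ _ _ _ _ H)|].
    intros z Hz. left. now apply (hb_h_bound _ _ _ _ _ H). }
  assert (HM : 0 <= M) by (eapply Rle_trans; [apply Cmod_ge_0|apply (Hle 1%nat); lia]).
  assert (HA : 0 <= A) by apply Cmod_ge_0.
  set (u := fun k => (Cmod (a (S k)) + Cmod (b (S k))) * r ^ S k).
  set (v := fun k => M * (bohr_weight k * r ^ S k)).
  assert (Huv : forall k, 0 <= u k <= v k).
  { intros k. unfold u, v, bohr_weight. rewrite (bohr_class_coeff _ _ _ _ _ k H).
    assert (Hp : 0 <= r ^ S k) by (apply pow_le; lra).
    assert (Hq := proj1 (ratio_bounds k)).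
    assert (Ha := Cmod_ge_0 (a k)). assert (HaS := Cmod_ge_0 (a (S k))).
    assert (H1 := Hle (S k) ltac:(lia)).
    assert (H2 : INR k / INR (S k) * Cmod (a k) <= INR k / INR (S k) * M).
    { destruct k as [|k]; [simpl; lra|]. apply Rmult_le_compat_l; [exact Hq|]. apply Hle. lia. }
    split.
    - apply Rmult_le_pos; [|exact Hp]. assert (0 <= INR k / INR (S k) * Cmod (a k)) by now apply Rmult_le_pos. lra.
    - rewrite <- Rmult_assoc. apply Rmult_le_compat_r; [exact Hp|]. lra. }
  assert (Hv : is_series v (M * bohr_majorant r)).
  { apply (is_series_scal (V:=R_NormedModule)). now apply is_series_bohr_majorant. }
  assert (Hu : ex_series u).
  { apply (ex_series_le (V:=R_CompleteNormedModule)) with v; [|eexists; exact Hv].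
    intros k. change (Rabs (u k) <= v k). rewrite Rabs_pos_eq; apply Huv. }
  exists (Series u). split; [exact (Series_correct _ Hu)|].
  assert (Hs : Series u <= M * bohr_majorant r).
  { rewrite <- (is_series_unique _ _ Hv). apply Series_le; [exact Huv|eexists; exact Hv]. }
  assert (Hmaj : bohr_majorant r <= 1 / 2).
  { assert (E := bohr_majorant_fun r ltac:(lra)).
    assert ((bohr_fun r - 1) / (1 - r) <= 0); [|lra].
    apply Rmult_le_reg_r with (1 - r); [lra|]. unfold Rdiv.
    rewrite Rmult_assoc, Rinv_l by lra. lra. }
  fold A. apply Rle_trans with (A + M * (1 / 2)).
  - assert (M * bohr_majorant r <= M * (1 / 2)) by now apply Rmult_le_compat_l. lra.
  - unfold M. assert (0 <= (1 - A) ^ 2) by apply pow2_ge_0. lra.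
Qed.

(** * Real parts of power series are harmonic *)

(** Sums of power series in the disk form a class stable under complex differentiation,
    which makes induction on the order of differentiability possible. *)
Definition disk_pseries_fun (F : C -> C) : Prop :=
  exists c, forall z, in_disk z -> is_cpseries c z (F z).

Lemma disk_pseries_fun_derive (F : C -> C) : disk_pseries_fun F ->
  exists F', disk_pseries_fun F' /\
    forall z, in_disk z -> @is_derive C_AbsRing C_NormedModule F z (F' z).
Proof.
  intros [c Hc]. exists (cpseries_sum (cderive c)). split.
  - exists (cderive c). intros z Hz. apply cpseries_sum_correct; [|exact Hz].
    apply disk_coeffs_cderive, disk_coeffs_of_cv. eauto.
  - intros z Hz. now apply is_derive_cpseries_sum.
Qed.

Lemma disk_pseries_fun_lin (x y : C) (F G : C -> C) :
  disk_pseries_fun F -> disk_pseries_fun G -> disk_pseries_fun (fun z => x * F z + y * G z)%C.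
Proof.
  intros [c Hc] [d Hd].
  exists (PS_plus (V:=C_NormedModule) (PS_scal (V:=C_NormedModule) x c) (PS_scal (V:=C_NormedModule) y d)).
  intros z Hz. apply (is_pseries_plus (V:=C_NormedModule));
    (apply (is_pseries_scal (V:=C_NormedModule)); [apply Cmult_comm|auto]).
Qed.

Lemma disk_pseries_fun_scal (x : C) (F : C -> C) :
  disk_pseries_fun F -> disk_pseries_fun (fun z => x * F z)%C.
Proof.
  intros [c Hc]. exists (PS_scal (V:=C_NormedModule) x c).
  intros z Hz. apply (is_pseries_scal (V:=C_NormedModule)); [apply Cmult_comm|auto].
Qed.

Lemma Cmod_pair_le (x y : R) : Cmod (x, y) <= Rabs x + Rabs y.
Proof.
  replace ((x, y) : C) with (RtoC x + Ci * RtoC y)%C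
    by (apply injective_projections; simpl; ring).
  eapply Rle_trans; [apply Cmod_triangle|]. rewrite Cmod_mult, Cmod_Ci, !Cmod_R. lra.
Qed.

Lemma locally_2d_Cmod (P : C -> Prop) (x y delta : R) : 0 < delta ->
  (forall w, Cmod (w - (x, y)) < delta -> P w) -> locally_2d (fun u v => P (u, v)) x y.
Proof.
  intros Hd HP. assert (Hd2 : 0 < delta / 2) by lra.
  exists (mkposreal _ Hd2). simpl. intros u v Hu Hv. apply HP.
  change (Cmod (u - x, v - y) < delta).
  eapply Rle_lt_trans; [apply Cmod_pair_le|]. lra.
Qed.

Lemma in_disk_near (z w : C) : Cmod (w - z) < 1 - Cmod z -> in_disk w.
Proof.
  intros H. unfold in_disk. replace w with (w - z + z)%C by ring.
  eapply Rle_lt_trans; [apply Cmod_triangle|]. lra.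
Qed.

Lemma is_derive_C_eps (F : C -> C) (z l : C) (eps : R) :
  @is_derive C_AbsRing C_NormedModule F z l -> 0 < eps ->
  exists delta, 0 < delta /\ forall w, Cmod (w - z) < delta ->
    Cmod (F w - F z - (w - z) * l) <= eps * Cmod (w - z).
Proof.
  intros [_ H] He.
  specialize (H z (fun P HP => HP) (mkposreal _ He)).
  destruct (locally_norm_le_locally (V:=AbsRing_NormedModule C_AbsRing) z _ H) as [delta Hdelta].
  exists delta. split; [apply cond_pos|]. intros w Hw. exact (Hdelta w Hw).
Qed.

(** The two partial derivatives of Re F are the cases d = 1 and d = i.  Only the values of
    [u] inside the disk are constrained, so that a partial derivative of Re F, known only
    there, can be differentiated again. *)
Lemma is_derive_Re_path (F : C -> C) (u : R -> R) (gam : R -> C) (t0 : R) (d l : C) :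
  in_disk (gam t0) ->
  (forall t, gam t - gam t0 = RtoC (t - t0) * d)%C ->
  (forall t, in_disk (gam t) -> u t = Re (F (gam t))) ->
  @is_derive C_AbsRing C_NormedModule F (gam t0) l ->
  is_derive u t0 (Re (d * l)%C).
Proof.
  intros Hz Hg Hu HF. split; [apply is_linear_scal_l|].
  intros x Hx. apply (is_filter_lim_locally_unique (V:=R_NormedModule)) in Hx. subst x.
  intros eps.
  set (D := Cmod d + 1). assert (Hd := Cmod_ge_0 d).
  assert (He : 0 < eps / D) by (apply Rdiv_lt_0_compat; [apply cond_pos|unfold D; lra]).
  destruct (is_derive_C_eps F _ l _ HF He) as [delta [Hdelta HD]].
  assert (Hz1 : Cmod (gam t0) < 1) by exact Hz.
  assert (Hm : 0 < Rmin delta (1 - Cmod (gam t0)) / D).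
  { apply Rdiv_lt_0_compat; [apply Rmin_pos; lra|unfold D; lra]. }
  exists (mkposreal _ Hm). intros t Ht.
  change (Rabs (t - t0) < Rmin delta (1 - Cmod (gam t0)) / D) in Ht.
  change (Rabs (u t - u t0 - (t - t0) * Re (d * l)) <= eps * Rabs (t - t0)).
  assert (E : Cmod (gam t - gam t0) = Rabs (t - t0) * Cmod d) by now rewrite Hg, Cmod_mult, Cmod_R.
  assert (Habs := Rabs_pos (t - t0)).
  assert (Hlt : Cmod (gam t - gam t0) < Rmin delta (1 - Cmod (gam t0))).
  { rewrite E. apply Rle_lt_trans with (Rabs (t - t0) * D); [unfold D; nra|].
    apply Rmult_lt_reg_r with (/ D); [apply Rinv_0_lt_compat; unfold D; lra|].
    rewrite Rmult_assoc, Rinv_r, Rmult_1_r by (unfold D; lra). exact Ht. }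
  assert (H1 := Rmin_l delta (1 - Cmod (gam t0))). assert (H2 := Rmin_r delta (1 - Cmod (gam t0))).
  specialize (HD (gam t) ltac:(lra)).
  rewrite (Hu t), (Hu t0) by (trivial; apply (in_disk_near (gam t0)); lra).
  replace (Re (F (gam t)) - Re (F (gam t0)) - (t - t0) * Re (d * l)%C)
    with (Re (F (gam t) - F (gam t0) - (gam t - gam t0) * l)%C).
  2: { rewrite Hg. destruct d, l, (F (gam t)), (F (gam t0)); simpl. ring. }
  eapply Rle_trans; [apply re_le_Cmod|]. eapply Rle_trans; [exact HD|]. rewrite E.
  replace (eps / D * (Rabs (t - t0) * Cmod d)) with (eps * Rabs (t - t0) * (Cmod d / D)) by (field; unfold D; lra).
  rewrite <- (Rmult_1_r (eps * Rabs (t - t0))) at 2.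
  apply Rmult_le_compat_l; [apply Rmult_le_pos; [left; apply cond_pos|exact Habs]|].
  apply Rmult_le_reg_r with D; [unfold D; lra|]. unfold Rdiv. rewrite Rmult_assoc, Rinv_l; unfold D; lra.
Qed.

Section real_part.

Variables (F F' : C -> C) (u : R -> R -> R).
Hypothesis HF : forall z, in_disk z -> @is_derive C_AbsRing C_NormedModule F z (F' z).
Hypothesis Hu : forall x y, in_disk (x, y) -> u x y = Re (F (x, y)).

Lemma is_derive_Re_x (x y : R) : in_disk (x, y) -> is_derive (fun t => u t y) x (Re (F' (x, y))).
Proof.
  intros Hz. rewrite <- (Cmult_1_l (F' (x, y))).
  apply (is_derive_Re_path F _ (fun t => (t, y))); auto.
  intros t. apply injective_projections; simpl; ring.
Qed.

Lemma is_derive_Re_y (x y : R) : in_disk (x, y) -> is_derive (fun t => u x t) y (Re (Ci * F' (x, y))).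
Proof.
  intros Hz. apply (is_derive_Re_path F _ (fun t => (x, t))); auto.
  intros t. apply injective_projections; simpl; ring.
Qed.

Lemma continuity_2d_Re (x y : R) : in_disk (x, y) -> continuity_2d_pt u x y.
Proof.
  intros Hz eps. set (z := (x, y) : C). set (l := F' z).
  assert (Hl := Cmod_ge_0 l).
  destruct (is_derive_C_eps F z l 1 (HF z Hz) Rlt_0_1) as [delta [Hdelta HD]].
  assert (Hz1 : Cmod z < 1) by exact Hz.
  set (m := Rmin (Rmin delta (1 - Cmod z)) (eps / (Cmod l + 1))).
  assert (Hm : 0 < m).
  { repeat apply Rmin_pos; try lra. apply Rdiv_lt_0_compat; [apply cond_pos|lra]. }
  apply (locally_2d_Cmod (fun w => Rabs (u (Re w) (Im w) - u x y) < eps) x y m Hm).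
  intros w Hw. fold z in Hw.
  assert (H1 : m <= delta) by (unfold m; eapply Rle_trans; [apply Rmin_l|apply Rmin_l]).
  assert (H2 : m <= 1 - Cmod z) by (unfold m; eapply Rle_trans; [apply Rmin_l|apply Rmin_r]).
  assert (H3 : m <= eps / (Cmod l + 1)) by apply Rmin_r.
  assert (Hwd : in_disk w) by (apply (in_disk_near z); lra).
  rewrite (Hu x y Hz), (Hu (Re w) (Im w)) by (destruct w; exact Hwd).
  replace (Re w, Im w) with w by now destruct w.
  change (Re (F w) - Re (F (x, y))) with (Re (F w - F z)%C).
  eapply Rle_lt_trans; [apply re_le_Cmod|].
  replace (F w - F z)%C with ((F w - F z - (w - z) * l) + (w - z) * l)%C by ring.
  eapply Rle_lt_trans; [apply Cmod_triangle|]. rewrite Cmod_mult.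
  specialize (HD w ltac:(lra)).
  apply Rle_lt_trans with (Cmod (w - z) * (Cmod l + 1)); [lra|].
  apply Rlt_le_trans with (eps / (Cmod l + 1) * (Cmod l + 1)).
  - apply Rmult_lt_compat_r; lra.
  - right. field. lra.
Qed.

End real_part.

(** The partial derivatives of Re F are Re F' and Re (i F'), again real parts of power
    series. *)
Lemma ex_diff_n_Re (n : nat) (F : C -> C) (u : R -> R -> R) (x y : R) :
  disk_pseries_fun F -> (forall x y, in_disk (x, y) -> u x y = Re (F (x, y))) ->
  in_disk (x, y) -> ex_diff_n u n x y.
Proof.
  revert F u x y. induction n as [|n IH]; intros F u x y HF Hu Hz;
    destruct (disk_pseries_fun_derive F HF) as [F' [HF' HD]].
  - split; [|exact I]. exact (continuity_2d_Re F F' u HD Hu x y Hz).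
  - repeat split.
    + exact (continuity_2d_Re F F' u HD Hu x y Hz).
    + eexists. exact (is_derive_Re_x F F' u HD Hu x y Hz).
    + eexists. exact (is_derive_Re_y F F' u HD Hu x y Hz).
    + apply (IH F'); auto. intros s t Hst. apply is_derive_unique.
      exact (is_derive_Re_x F F' u HD Hu s t Hst).
    + apply (IH (fun z => Ci * F' z)%C); auto; [now apply disk_pseries_fun_scal|].
      intros s t Hst. apply is_derive_unique.
      exact (is_derive_Re_y F F' u HD Hu s t Hst).
Qed.

Lemma locally_in_disk (x y : R) : in_disk (x, y) ->
  locally x (fun t => in_disk (t, y)) /\ locally y (fun t => in_disk (x, t)).
Proof.
  intros Hz. assert (Hd : 0 < 1 - Cmod (x, y)) by (unfold in_disk in Hz; lra).
  split; exists (mkposreal _ Hd); intros t Ht; apply (in_disk_near (x, y)).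
  - change (Rabs (t - x) < 1 - Cmod (x, y)) in Ht.
    change (Cmod (t - x, y - y) < 1 - Cmod (x, y)).
    eapply Rle_lt_trans; [apply Cmod_pair_le|]. rewrite Rminus_diag, Rabs_R0. lra.
  - change (Rabs (t - y) < 1 - Cmod (x, y)) in Ht.
    change (Cmod (x - x, t - y) < 1 - Cmod (x, y)).
    eapply Rle_lt_trans; [apply Cmod_pair_le|]. rewrite Rminus_diag, Rabs_R0. lra.
Qed.

(** The second derivatives are Re F'' and Re (i^2 F''). *)
Lemma harmonic_Re (F : C -> C) (u : R -> R -> R) :
  disk_pseries_fun F -> (forall x y, in_disk (x, y) -> u x y = Re (F (x, y))) ->
  harmonic_fun_in_disk u.
Proof.
  intros HF Hu x y Hz. split; [now apply (ex_diff_n_Re 2 F)|].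
  destruct (disk_pseries_fun_derive F HF) as [F' [HF' HD]].
  destruct (disk_pseries_fun_derive F' HF') as [F'' [HF'' HD']].
  destruct (disk_pseries_fun_derive _ (disk_pseries_fun_scal Ci _ HF')) as [G [HG HDG]].
  destruct (locally_in_disk x y Hz) as [Lx Ly].
  assert (EG : G (x, y) = (Ci * F'' (x, y))%C).
  { rewrite <- (is_C_derive_unique _ _ _ (HDG _ Hz)). apply is_C_derive_unique.
    assert (HS := filterdiff_scal_r_fct (K:=C_AbsRing) (V:=C_NormedModule) Ci _ _ Cmult_comm (HD' _ Hz)).
    apply (filterdiff_ext_lin (K:=C_AbsRing) (U:=AbsRing_NormedModule C_AbsRing) (V:=C_NormedModule) _ _ (fun w : C => w * (Ci * F'' (x, y)))%C HS).
    intros w. change (Ci * (w * F'' (x, y)) = w * (Ci * F'' (x, y)))%C. ring. }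
  unfold partial_derive. simpl.
  rewrite (Derive_ext_loc (fun t => Derive (fun t => u t y) t) (fun t => Re (F' (t, y)))).
  2: { apply filter_imp with (2 := Lx). intros t Ht. apply is_derive_unique.
    exact (is_derive_Re_x F F' u HD Hu t y Ht). }
  rewrite (Derive_ext_loc (fun t => Derive (fun t => u x t) t) (fun t => Re (Ci * F' (x, t))%C)).
  2: { apply filter_imp with (2 := Ly). intros t Ht. apply is_derive_unique.
    exact (is_derive_Re_y F F' u HD Hu x t Ht). }
  assert (E1 : Derive (fun t : R => Re (F' (t, y))) x = Re (F'' (x, y))).
  { apply is_derive_unique.
    exact (is_derive_Re_x F' F'' (fun s t => Re (F' (s, t))) HD' (fun _ _ _ => eq_refl) x y Hz). }
  assert (E2 : Derive (fun t : R => Re (Ci * F' (x, t))%C) y = Re (Ci * G (x, y))).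
  { apply is_derive_unique.
    exact (is_derive_Re_y (fun z => Ci * F' z)%C G (fun s t => Re (Ci * F' (s, t))%C) HDG
      (fun _ _ _ => eq_refl) x y Hz). }
  change (Derive (fun t : R => Re (F' (t, y))) x + Derive (fun t : R => Re (Ci * F' (x, t))) y = 0).
  rewrite E1, E2, EG. destruct (F'' (x, y)); simpl. ring.
Qed.

(** * Sharpness *)

Lemma disk_coeffs_bounded (c : nat -> C) (M : R) :
  (forall k, Cmod (c k) <= M) -> disk_coeffs c.
Proof.
  intros H r Hr.
  apply (ex_series_le (V:=R_CompleteNormedModule)) with (fun k => M * r ^ k).
  - intros k. assert (0 <= r ^ k) by (apply pow_le; lra).
    change (Rabs (Cmod (c k) * r ^ k) <= M * r ^ k).
    rewrite Rabs_pos_eq by (apply Rmult_le_pos; [apply Cmod_ge_0|assumption]).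
    now apply Rmult_le_compat_r.
  - apply (ex_series_scal (V:=R_NormedModule)). apply ex_series_geom. rewrite Rabs_pos_eq; lra.
Qed.

(** The sum l of the series satisfies l = 1 + q l. *)
Lemma is_cseries_geom (q : C) : Cmod q < 1 -> is_cseries (fun k => q ^ k)%C (/ (1 - q))%C.
Proof.
  intros Hq.
  destruct (ex_series_le (V:=C_CompleteNormedModule) (fun k => q ^ k)%C (fun k => Cmod q ^ k)) as [l Hl].
  - intros k. change (Cmod (q ^ k) <= Cmod q ^ k). rewrite Cmod_pow. lra.
  - apply ex_series_geom. rewrite Rabs_pos_eq; [exact Hq|apply Cmod_ge_0].
  - assert (Hl' : is_cseries (fun k => q ^ k)%C (q * l + 1)%C).
    { apply is_series_decr_1.
      assert (HS := is_series_scal (V:=C_NormedModule) q _ _ Hl).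
      refine (eq_ind _ (is_cseries (fun k => q ^ S k)%C) HS _ _).
      change (q * l = (q * l + 1) + - q ^ 0)%C. simpl. ring. }
    assert (E := is_cseries_unique _ _ _ Hl Hl').
    assert (Hne : (1 - q <> 0)%C).
    { intros E0. assert (Cmod 1 <= Cmod q); [|rewrite Cmod_1 in *; lra].
      replace q with (RtoC 1 - (1 - q))%C by ring. rewrite E0.
      right. f_equal. ring. }
    replace (/ (1 - q))%C with l; [exact Hl|].
    apply (f_equal (fun t => t - q * l)%C) in E.
    replace (l - q * l)%C with ((1 - q) * l)%C in E by ring.
    replace (q * l + 1 - q * l)%C with (RtoC 1) in E by ring.
    change (@eq C l (/ (1 - q)))%C.
    apply (f_equal (Cmult (/ (1 - q)))) in E.
    rewrite Cmult_assoc, Cinv_l, Cmult_1_l, Cmult_1_r in E by exact Hne. exact E.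
Qed.

Section extremal.

Variable al : R.
Hypothesis Hal : 0 < al < 1.

Definition mobius (z : C) : C := ((RtoC al - z) / (1 - RtoC al * z))%C.

Definition mobius_coeff (k : nat) : C :=
  match k with O => RtoC al | S k => RtoC (- ((1 - al ^ 2) * al ^ k)) end.

(** Chosen so that g' = z h'. *)
Definition comobius_coeff (k : nat) : C :=
  match k with O => RtoC 0 | S k => (RtoC (INR k / INR (S k)) * mobius_coeff k)%C end.

Lemma comobius_coeff_S (k : nat) :
  comobius_coeff (S k) = (RtoC (INR k / INR (S k)) * mobius_coeff k)%C.
Proof. reflexivity. Qed.

Lemma Cmod_al_mult (z : C) : in_disk z -> Cmod (RtoC al * z) < 1.
Proof.
  intros Hz. unfold in_disk in Hz. rewrite Cmod_mult, Cmod_R, Rabs_pos_eq by lra.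
  assert (H := Cmod_ge_0 z). nra.
Qed.

Lemma mobius_denom (z : C) : in_disk z -> (1 - RtoC al * z <> 0)%C.
Proof.
  intros Hz E0. assert (H := Cmod_al_mult z Hz).
  assert (Cmod 1 <= Cmod (RtoC al * z)); [|rewrite Cmod_1 in *; lra].
  replace (RtoC al * z)%C with (RtoC 1 - (1 - RtoC al * z))%C by ring. rewrite E0.
  right. f_equal. ring.
Qed.

Lemma is_cpseries_mobius (z : C) : in_disk z -> is_cpseries mobius_coeff z (mobius z).
Proof.
  intros Hz. apply is_cpseries_iff. apply is_series_decr_1.
  assert (HS := is_series_scal (V:=C_NormedModule) (- RtoC (1 - al ^ 2) * z)%C _ _ (is_cseries_geom _ (Cmod_al_mult z Hz))).
  assert (HS' : is_cseries (fun k => z ^ S k * mobius_coeff (S k))%C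
     ((- RtoC (1 - al ^ 2) * z) * / (1 - RtoC al * z))%C).
  { apply is_series_ext with (2 := HS). intros k.
    change ((- RtoC (1 - al ^ 2) * z) * (RtoC al * z) ^ k = z ^ S k * RtoC (- ((1 - al ^ 2) * al ^ k)))%C.
    rewrite RtoC_opp, RtoC_mult, (RtoC_pow al k), Cpow_mult_l. simpl. ring. }
  refine (eq_ind _ (is_cseries _) HS' _ _).
  change ((- RtoC (1 - al ^ 2) * z) * / (1 - RtoC al * z) = mobius z + - (z ^ 0 * RtoC al))%C.
  unfold mobius. rewrite RtoC_minus, (RtoC_pow al 2). simpl. field. now apply mobius_denom.
Qed.

Lemma Cmod_mobius (z : C) : in_disk z -> Cmod (mobius z) < 1.
Proof.
  intros Hz. assert (Hd := mobius_denom z Hz). unfold mobius. rewrite Cmod_div by exact Hd.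
  apply Cmod_gt_0 in Hd.
  apply Rmult_lt_reg_r with (Cmod (1 - RtoC al * z)); [exact Hd|].
  unfold Rdiv. rewrite Rmult_assoc, Rinv_l, Rmult_1_r, Rmult_1_l by lra.
  apply Rsqr_incrst_0; try apply Cmod_ge_0.
  rewrite !Rsqr_pow2, !Cmod2_alt.
  assert (Hz2 : Re z ^ 2 + Im z ^ 2 < 1).
  { rewrite <- Cmod2_alt. unfold in_disk in Hz. assert (H := Cmod_ge_0 z). nra. }
  destruct z as [x y]. simpl Re in *. simpl Im in *.
  (* |1 - al z|^2 - |al - z|^2, factored *)
  assert (H : 0 < (1 - al ^ 2) * (1 - (x ^ 2 + y ^ 2))) by (apply Rmult_lt_0_compat; nra).
  simpl in *. lra.
Qed.

Lemma Cmod_mobius_coeff (k : nat) : Cmod (mobius_coeff (S k)) = (1 - al ^ 2) * al ^ k.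
Proof.
  simpl mobius_coeff. rewrite Cmod_R, Rabs_Ropp, Rabs_pos_eq; [reflexivity|].
  apply Rmult_le_pos; [nra|apply pow_le; lra].
Qed.

Lemma comobius_coeff_eq (k : nat) :
  cderive comobius_coeff k = PS_incr_1 (V:=C_NormedModule) (cderive mobius_coeff) k.
Proof.
  unfold cderive at 1. rewrite comobius_coeff_S, Cmult_assoc, <- RtoC_mult.
  replace (INR (S k) * (INR k / INR (S k))) with (INR k) by (field; apply not_0_INR; lia).
  destruct k as [|k]; [|reflexivity].
  change (RtoC 0 * mobius_coeff 0 = 0)%C. ring.
Qed.

Lemma disk_coeffs_comobius : disk_coeffs comobius_coeff.
Proof.
  apply disk_coeffs_bounded with 1. intros [|k].
  - simpl. rewrite Cmod_0. lra.
  - assert (Hq := ratio_bounds k).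
    assert (Hm : 0 <= Cmod (mobius_coeff k) <= 1).
    { split; [apply Cmod_ge_0|]. destruct k as [|k].
      - simpl. rewrite Cmod_R, Rabs_pos_eq; lra.
      - rewrite Cmod_mobius_coeff. assert (0 <= al ^ k <= 1).
        { split; [apply pow_le; lra|]. rewrite <- (pow1 k). apply pow_incr. lra. }
        assert (0 < 1 - al ^ 2 < 1) by nra. nra. }
    rewrite comobius_coeff_S. rewrite Cmod_mult, Cmod_R, Rabs_pos_eq by lra. nra.
Qed.

Definition comobius : C -> C := cpseries_sum comobius_coeff.

Lemma is_cpseries_comobius (z : C) : in_disk z -> is_cpseries comobius_coeff z (comobius z).
Proof. intros Hz. apply cpseries_sum_correct; [apply disk_coeffs_comobius|exact Hz]. Qed.

(** Im (h + conj g) is Im (h - g), the real part of -i h + i g. *)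
Lemma mobius_bohr_class :
  harmonic_bohr_class (fun z => mobius z + Cconj (comobius z))%C mobius comobius
    mobius_coeff comobius_coeff.
Proof.
  assert (Hh : disk_pseries_fun mobius) by (eexists; exact is_cpseries_mobius).
  assert (Hg : disk_pseries_fun comobius) by (eexists; exact is_cpseries_comobius).
  constructor.
  - split.
    + apply (harmonic_Re (fun z => 1 * mobius z + 1 * comobius z)%C).
      * now apply disk_pseries_fun_lin.
      * intros x y _. destruct (mobius (x, y)), (comobius (x, y)); simpl. ring.
    + apply (harmonic_Re (fun z => - Ci * mobius z + Ci * comobius z)%C).
      * now apply disk_pseries_fun_lin.
      * intros x y _. destruct (mobius (x, y)), (comobius (x, y)); simpl. ring.
  - reflexivity.
  - intros z Hz. eexists. exact (is_derive_cpseries_sum _ _ z is_cpseries_mobius Hz).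
  - intros z Hz. eexists. exact (is_derive_cpseries_sum _ _ z is_cpseries_comobius Hz).
  - exact is_cpseries_mobius.
  - reflexivity.
  - exact is_cpseries_comobius.
  - exact Cmod_mobius.
  - intros z Hz. f_equal.
    assert (H1 := C_derive_cpseries _ _ z is_cpseries_comobius Hz).
    assert (H2 := is_pseries_incr_1 (V:=C_NormedModule) _ _ _ (C_derive_cpseries _ _ z is_cpseries_mobius Hz)).
    apply is_cpseries_iff in H1. apply is_cpseries_iff in H2.
    refine (is_cseries_unique _ _ _ H1 _).
    apply is_series_ext with (2 := H2). intros k. now rewrite comobius_coeff_eq.
Qed.

(** Powers of al only decrease, so the sum at radius r dominates (1 - al^2) times the
    majorant at radius al r; adding |a_0| = al then exceeds 1. *)
Lemma mobius_not_bohr (r : R) : 0 <= al * r < 1 -> 0 <= r ->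
  1 < (1 + al) * bohr_majorant (al * r) ->
  ~ bohr_inequality mobius_coeff comobius_coeff r.
Proof.
  intros Hr Hr0 Hmaj [s [Hs Hle]].
  assert (HM : 0 < 1 - al ^ 2) by nra.
  assert (HS : is_series (fun k => (1 - al ^ 2) * (bohr_weight k * (al * r) ^ S k))
    ((1 - al ^ 2) * bohr_majorant (al * r))).
  { apply (is_series_scal (V:=R_NormedModule)). now apply is_series_bohr_majorant. }
  assert (H : (1 - al ^ 2) * bohr_majorant (al * r) <= s).
  { rewrite <- (is_series_unique _ _ HS), <- (is_series_unique _ _ Hs).
    apply Series_le; [|eexists; exact Hs]. intros k.
    assert (Hq := proj1 (ratio_bounds k)).
    assert (Hp : forall j, 0 <= (1 - al ^ 2) * al ^ j).
    { intros j. apply Rmult_le_pos; [lra|apply pow_le; lra]. }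
    assert (Hrk : 0 <= r ^ S k) by (apply pow_le; lra).
    split.
    - apply Rmult_le_pos; [lra|]. apply Rmult_le_pos; [unfold bohr_weight; lra|apply pow_le; lra].
    - rewrite Cmod_mobius_coeff. rewrite comobius_coeff_S.
      rewrite Cmod_mult, Cmod_R, Rabs_pos_eq by exact Hq.
      rewrite Rpow_mult_distr, <- !Rmult_assoc. apply Rmult_le_compat_r; [exact Hrk|].
      unfold bohr_weight.
      assert (H1 : (1 - al ^ 2) * al ^ S k <= (1 - al ^ 2) * al ^ k).
      { apply Rmult_le_compat_l; [lra|]. assert (0 <= al ^ k) by (apply pow_le; lra). simpl. nra. }
      assert (H2 : INR k / INR (S k) * ((1 - al ^ 2) * al ^ S k) <= INR k / INR (S k) * Cmod (mobius_coeff k)).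
      { destruct k as [|k]; [simpl; lra|]. apply Rmult_le_compat_l; [exact Hq|].
        rewrite Cmod_mobius_coeff. apply Rmult_le_compat_l; [lra|].
        assert (0 <= al ^ k) by (apply pow_le; lra). simpl. nra. }
      lra. }
  simpl mobius_coeff in Hle. rewrite Cmod_R, Rabs_pos_eq in Hle by lra.
  nra.
Qed.

End extremal.

(** Fix r_1 between r_0 and min(rho, 1), where the majorant exceeds 1/2, and take
    r = r_1 / al with al close enough to 1. *)
Lemma bohr_radius_sharp (r0 rho : R) : 0 < r0 < 1 -> bohr_fun r0 = 1 -> r0 < rho ->
  exists al r, 0 < al < 1 /\ 0 <= r < 1 /\ r <= rho /\ 0 <= al * r < 1 /\
    1 < (1 + al) * bohr_majorant (al * r).
Proof.
  intros Hr0 E Hrho.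
  set (m := Rmin rho 1).
  assert (Hm : r0 < m) by (apply Rmin_glb_lt; lra).
  assert (Hm1 : m <= 1) by apply Rmin_r. assert (Hm2 : m <= rho) by apply Rmin_l.
  set (r1 := (r0 + m) / 2).
  assert (Hr1 : r0 < r1 < m) by (unfold r1; lra).
  assert (Hmaj : 1 / 2 < bohr_majorant r1).
  { assert (H1 := bohr_fun_incr r0 r1 ltac:(lra) ltac:(lra) ltac:(lra)).
    assert (H2 := bohr_majorant_fun r1 ltac:(lra)).
    assert (0 < (bohr_fun r1 - 1) / (1 - r1)) by (apply Rdiv_lt_0_compat; lra). lra. }
  set (M := bohr_majorant r1) in *.
  set (q := Rmax (r1 / m) (/ M - 1)).
  assert (Hq1 : r1 / m <= q) by apply Rmax_l. assert (Hq2 : / M - 1 <= q) by apply Rmax_r.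
  assert (Hq : q < 1).
  { apply Rmax_lub_lt.
    - apply Rmult_lt_reg_r with m; [lra|]. unfold Rdiv. rewrite Rmult_assoc, Rinv_l; lra.
    - apply Rmult_lt_reg_r with M; [lra|]. rewrite Rmult_minus_distr_r, Rinv_l; lra. }
  assert (Hq0 : 0 < r1 / m) by (apply Rdiv_lt_0_compat; lra).
  set (al := (q + 1) / 2).
  assert (Hal : q < al < 1) by (unfold al; lra).
  exists al, (r1 / al).
  assert (Hr : al * (r1 / al) = r1) by (field; lra).
  assert (Hrm : r1 / al < m).
  { apply Rmult_lt_reg_r with al; [lra|]. unfold Rdiv at 1. rewrite Rmult_assoc, Rinv_l, Rmult_1_r by lra.
    replace r1 with (r1 / m * m) by (field; lra).
    rewrite (Rmult_comm m). apply Rmult_lt_compat_r; lra. }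
  assert (0 < r1 / al) by (apply Rdiv_lt_0_compat; lra).
  rewrite Hr. repeat split; try lra.
  fold M. apply Rmult_lt_reg_r with (/ M); [apply Rinv_0_lt_compat; lra|].
  rewrite Rmult_assoc, Rinv_r; lra.
Qed.

Theorem proposition1 :
  exists r0 : R,
    unique (fun x : R => 0 < x < 1 /\ 5 * x + 2 * (1 - x) * ln (1 - x) = 1) r0 /\
    Rabs (r0 - 0.299824) < 0.0000005 /\
    (forall (f h g : C -> C) (a b : nat -> C),
        harmonic_bohr_class f h g a b ->
        forall r : R, 0 <= r <= r0 -> bohr_inequality a b r) /\
    (forall rho : R, r0 < rho ->
        exists (f h g : C -> C) (a b : nat -> C) (r : R),
          harmonic_bohr_class f h g a b /\
          0 <= r < 1 /\ r <= rho /\ ~ bohr_inequality a b r).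
Proof.
  destruct bohr_radius_exists as [r0 [Hr0 E]].
  exists r0. split; [split|split; [|split]].
  - split; [lra|exact E].
  - intros x [Hx Ex]. change (bohr_fun x = 1) in Ex.
    destruct (Rtotal_order r0 x) as [Hlt|[Heq|Hgt]]; [|exact Heq|].
    + assert (H := bohr_fun_incr r0 x ltac:(lra) Hlt ltac:(lra)). lra.
    + assert (H := bohr_fun_incr x r0 ltac:(lra) Hgt ltac:(lra)). lra.
  - apply Rabs_def1; lra.
  - intros f h g a b H r Hr. apply (bohr_class_inequality f h g); [exact H|lra|].
    destruct (Req_dec r r0) as [->|Hne]; [lra|].
    assert (H' := bohr_fun_incr r r0 ltac:(lra) ltac:(lra) ltac:(lra)). lra.
  - intros rho Hrho.
    destruct (bohr_radius_sharp r0 rho ltac:(lra) E Hrho) as [al [r [Hal [Hr [Hrr [Hp Hmaj]]]]]].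
    exists (fun z => mobius al z + Cconj (comobius al z))%C, (mobius al), (comobius al),
      (mobius_coeff al), (comobius_coeff al), r.
    split; [now apply mobius_bohr_class|].
    split; [exact Hr|]. split; [exact Hrr|].
    apply mobius_not_bohr; auto. lra.
Qed.
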